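(* Let $n\ge 1$, let $A\in\mathbb{Z}^{n\times n}$ be a symmetric integral matrix of signature $(n-1,-1)$, let $\mathcal{V}_1^{>0},\mathcal{V}_2^{>0}\subset\mathbb{R}^n$ be the dual cones attached to $A$, let $\Omega$ be the reduced automorphism group of $A$, and let $D=(\mathbb{Z}^n\cap\mathcal{V}_2^{\ge 0})\setminus\{0\}$ (all as defined in the context). Then the residue class graph $\Gamma_D/\Omega$ (the quotient of the $D$-Voronoi graph $\Gamma_D$ by the action of $\Omega$) is finite. In particular, the Voronoi procedure described in the context, applied to $\mathcal{V}_1^{>0},\mathcal{V}_2^{>0},D,\Omega$, terminates after finitely many steps.
   Context: Vectors in $\mathbb{R}^n$ are row vectors, $e_1$ is the first standard basis vector, $\sigma(x,y)=xy^{tr}$ is the standard scalar product, and groups of matrices act on $\mathbb{R}^n$ from the right. Signature $(n-1,-1)$ means $n-1$ positive eigenvalues and exactly one negative eigenvalue (so $A$ is nondegenerate). Cones. Let $H=\mathrm{diag}(-1,1,\dots,1)\in\mathbb{Z}^{n\times n}$ and $\mathcal{C}=\{x\in\mathbb{R}^n : xHx^{tr}<0,\ x_1>0\}$. Fix $T\in\mathrm{GL}_n(\mathbb{R})$ with $THT^{tr}=A$ and put $\mathcal{V}_1^{>0}=\mathcal{C}T^{-1}=\{x : xAx^{tr}<0,\ x(e_1T^{tr})^{tr}>0\}$ and $\mathcal{V}_2^{>0}=\mathcal{C}T^{tr}=\{x : xA^{-1}x^{tr}<0,\ x(e_1T^{-1})^{tr}>0\}$. Let $\mathcal{V}_i^{\ge0}$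 be the topological closure of $\mathcal{V}_i^{>0}$. Group. $\mathrm{Aut}_{\mathbb{Z}}(A)=\{g\in\mathrm{GL}_n(\mathbb{Z}) : gAg^{tr}=A\}$, and the reduced automorphism group is $\Omega=\{g\in\mathrm{Aut}_{\mathbb{Z}}(A) : \mathcal{V}_1^{>0}g=\mathcal{V}_1^{>0}\}$. For $x\in\mathcal{V}_1^{>0}$, $\Omega_x$ denotes the stabilizer of $x$ in $\Omega$. Perfect points. For $x\in\mathcal{V}_1^{>0}$ let $\mu_D(x)=\min_{d\in D}\sigma(x,d)$ and $M_D(x)=\{d\in D : \sigma(x,d)=\mu_D(x)\}$. The vector $x$ is $D$-perfect if $M_D(x)$ spans $\mathbb{R}^n$; $P_D$ is the set of all $D$-perfect $x$ with $\mu_D(x)=1$. Graph. A direction of $x\in P_D$ is a nonzero vector $r\in\mathbb{R}^n$ with $\sigma(r,d)\ge0$ for all $d\in M_D(x)$ and $\sigma(r,d)=0$ for $n-1$ linearly independent $d\in M_D(x)$. If $r\notin\mathcal{V}_1^{\ge0}$ (a non-blind direction), there is $\rho>0$ such that $y=x+\rho r\in P_D$; this $y$ is called the neighbour of $x$ in direction $r$, and $x,y$ are called contiguous. The $D$-Voronoi graph $\Gamma_D$ is the undirected graph with vertex set $P_D$ in which two vertices are adjacent iff they are contiguous; $\Omega$ acts on it, and $\Gamma_D/\Omega$ is the quotient graph. Voronoi procedure. (Each individual step is regarded as a single operation.) 1. Find $x_1\in P_D$; set $L_1=\{x_1\}$, $L_2=\emptyset$, $S=\emptyset$. 2. If $L_1=\emptyset$,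 return $L_2,S$ and stop; otherwise choose $x\in L_1$. 3. Compute a generating system $S_x$ of $\Omega_x$ and replace $S$ by $S\cup S_x$. 4. Compute the set $R$ of neighbours of $x$ and a transversal $R'$ of $R/\Omega_x$. 5. For each $y\in R'$ decide whether there are $z\in L_1\cup L_2$ and $\omega\in\Omega$ with $y\omega=z$. If not, replace $L_1$ by $L_1\cup\{y\}$. If so and $z\in L_1$, replace $S$ by $S\cup\{\omega\}$. 6. Replace $L_2$ by $L_2\cup\{x\}$ and $L_1$ by $L_1\setminus\{x\}$; go to step 2. *)

(* Defs.v *)
From HB Require Import structures.
From mathcomp Require Import all_boot all_order all_algebra.
From mathcomp Require Import all_classical all_reals all_analysis.

Set Implicit Arguments.
Unset Strict Implicit.
Unset Printing Implicit Defensive.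

Import Order.TTheory GRing.Theory Num.Theory.
Import numFieldNormedType.Exports.

Local Open Scope classical_set_scope.
Local Open Scope ring_scope.

(* Throughout, the dimension is n.+1, so that n : nat ranges over all
   dimensions >= 1.  Vectors are row vectors; matrices act from the right. *)

Section Vectors.
Variables (R : realType) (n : nat).
Implicit Types (x y v : 'rV[R]_n.+1) (M : set 'rV[R]_n.+1).

Definition sigma x y : R := (x *m y^T) 0 0.

Definition quad (B : 'M[R]_n.+1) x : R := (x *m B *m x^T) 0 0.

Definition int_mx m k (B : 'M[int]_(m, k)) : 'M[R]_(m, k) := map_mx intr B.

Definition act x (g : 'M[int]_n.+1) : 'rV[R]_n.+1 := x *m int_mx g.

(* the linear span of M is the whole space *)
Definition spans M : Prop :=
  forall v, exists k (B : 'M[R]_(k, n.+1)),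
    (forall i, M (row i B)) /\ (v <= B)%MS.

(* s lists the eigenvalues with their (algebraic) multiplicities *)
Definition has_eigenvalues (B : 'M[R]_n.+1) (s : seq R) : Prop :=
  char_poly B = \prod_(z <- s) ('X - z%:P).

(* dimension n.+1: n positive eigenvalues and exactly one negative one *)
Definition lorentzian (B : 'M[R]_n.+1) : Prop :=
  exists s, [/\ has_eigenvalues B s,
    count (fun z => 0 < z) s = n & count (fun z => z < 0) s = 1%N].

End Vectors.

Section Cones.
Variables (R : realType) (n : nat).

Definition Hmx : 'M[R]_n.+1 :=
  diag_mx (\row_i (if i == ord0 then -1 else 1)).

Definition coneC : set 'rV[R]_n.+1 :=
  [set x | quad Hmx x < 0 /\ 0 < x 0 ord0].

Definition coneV1 (T : 'M[R]_n.+1) : set 'rV[R]_n.+1 :=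
  [set x *m invmx T | x in coneC].

Definition coneV2 (T : 'M[R]_n.+1) : set 'rV[R]_n.+1 :=
  [set x *m T^T | x in coneC].

Definition lattice_points (V2 : set 'rV[R]_n.+1) : set 'rV[R]_n.+1 :=
  [set d | [/\ exists z : 'rV[int]_n.+1, d = int_mx R z,
               closure V2 d & d != 0]].

End Cones.

Section Groups.
Variables (R : realType) (n : nat).
Implicit Types (G S : set 'M[int]_n.+1) (x y : 'rV[R]_n.+1).

Definition AutZ (A : 'M[int]_n.+1) : set 'M[int]_n.+1 :=
  [set g | g \in unitmx /\ g *m A *m g^T = A].

Definition reduced_aut (A : 'M[int]_n.+1) (V1 : set 'rV[R]_n.+1) :
    set 'M[int]_n.+1 :=
  [set g | AutZ A g /\ [set act x g | x in V1] = V1].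

Definition stab G x : set 'M[int]_n.+1 := [set g | G g /\ act x g = x].

Definition orbit_of G x : set 'rV[R]_n.+1 := [set act x g | g in G].

(* subgroups of GL_(n.+1)(Z) *)
Definition is_subgroup G : Prop :=
  [/\ G `<=` [set g | g \in unitmx], G 1%:M,
      (forall g h, G g -> G h -> G (g *m h)) & (forall g, G g -> G (invmx g))].

Definition generates S G : Prop := smallest is_subgroup S = G.

(* T' is a transversal of the G-orbits on the G-stable set Y *)
Definition transversal_of G (Y T' : set 'rV[R]_n.+1) : Prop :=
  T' `<=` Y /\
  forall y, Y y -> exists! y', T' y' /\ orbit_of G y y'.

End Groups.

Section Voronoi.
Variables (R : realType) (n : nat).
Local Notation vec := 'rV[R]_n.+1.
Variables (V1 D : set vec).
Implicit Types (x y r : vec).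

(* the least element of X (0 if there is none) *)
Definition minimum (X : set R) : R := xget 0 [set m | X m /\ lbound X m].

Definition mu x : R := minimum [set sigma x d | d in D].

Definition min_vectors x : set vec := [set d | D d /\ sigma x d = mu x].

Definition perfect x : Prop := V1 x /\ spans (min_vectors x).

Definition perfect_points : set vec := [set x | perfect x /\ mu x = 1].

Definition direction x r : Prop :=
  [/\ r != 0,
      (forall d, min_vectors x d -> 0 <= sigma r d) &
      exists B : 'M[R]_(n, n.+1),
        row_free B /\
        forall i, min_vectors x (row i B) /\ sigma r (row i B) = 0].

Definition neighbours x : set vec :=
  [set y | exists r rho, [/\ direction x r, ~ closure V1 r, 0 < rho,
                             y = x + rho *: r & perfect_points y]].

(* The undirected graph with vertex set perfect_points; an edge is the
   unordered pair of its end points. *)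
Definition edges : set (set vec) :=
  [set e | exists x y,
     [/\ perfect_points x, neighbours x y & e = [set x; y]]].

Variable Omega : set 'M[int]_n.+1.

(* Vertices and edges of the quotient graph: the Omega-orbits of vertices
   and of edges. *)
Definition quotient_vertices : set (set vec) :=
  [set orbit_of Omega x | x in perfect_points].

Definition quotient_edges : set (set (set vec)) :=
  [set [set [set act x g | x in e] | g in Omega] | e in edges].

Definition quotient_graph_finite : Prop :=
  finite_set quotient_vertices /\ finite_set quotient_edges.

(* The Voronoi procedure as a nondeterministic transition system.  Step<k> is
   the configuration in which step k is executed next; the component `todo` of
   Step5 is the part of the transversal R' that has not been treated yet. *)
Inductive config : Type :=
| Step1
| Step2 of set vec & set vec & set 'M[int]_n.+1
| Step3 of vec & set vec & set vec & set 'M[int]_n.+1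
| Step4 of vec & set vec & set vec & set 'M[int]_n.+1
| Step5 of vec & set vec & set vec & set vec & set 'M[int]_n.+1
| Step6 of vec & set vec & set vec & set 'M[int]_n.+1
| Return of set vec & set 'M[int]_n.+1.

Inductive step : config -> config -> Prop :=
| step_start x1 :
    perfect_points x1 ->
    step Step1 (Step2 [set x1] set0 set0)
| step_return L2 S :
    step (Step2 set0 L2 S) (Return L2 S)
| step_choose x L1 L2 S :
    L1 x ->
    step (Step2 L1 L2 S) (Step3 x L1 L2 S)
| step_stabilizer x L1 L2 S Sx :
    generates Sx (stab Omega x) ->
    step (Step3 x L1 L2 S) (Step4 x L1 L2 (S `|` Sx))
| step_neighbours x L1 L2 S R' :
    transversal_of (stab Omega x) (neighbours x) R' ->
    step (Step4 x L1 L2 S) (Step5 x R' L1 L2 S)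
| step_new x todo L1 L2 S y :
    todo y ->
    ~ (exists z g, [/\ (L1 `|` L2) z, Omega g & act y g = z]) ->
    step (Step5 x todo L1 L2 S) (Step5 x (todo `\ y) (L1 `|` [set y]) L2 S)
| step_old_L1 x todo L1 L2 S y z g :
    todo y -> L1 z -> Omega g -> act y g = z ->
    step (Step5 x todo L1 L2 S) (Step5 x (todo `\ y) L1 L2 (S `|` [set g]))
| step_old_L2 x todo L1 L2 S y z g :
    todo y -> L2 z -> ~ L1 z -> Omega g -> act y g = z ->
    step (Step5 x todo L1 L2 S) (Step5 x (todo `\ y) L1 L2 S)
| step_loop_end x L1 L2 S :
    step (Step5 x set0 L1 L2 S) (Step6 x L1 L2 S)
| step_done x L1 L2 S :
    step (Step6 x L1 L2 S) (Step2 (L1 `\ x) (L2 `|` [set x]) S).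

(* Whatever choices are made, the run from c never gets stuck and reaches
   Return after finitely many steps. *)
Inductive terminates : config -> Prop :=
| terminates_return L2 S : terminates (Return L2 S)
| terminates_step c :
    (exists c', step c c') -> (forall c', step c c' -> terminates c') ->
    terminates c.

Definition voronoi_procedure_terminates : Prop := terminates Step1.

End Voronoi.

(* Main.v *)
Require Import Defs.
From HB Require Import structures.
From mathcomp Require Import all_boot all_order all_algebra.
From mathcomp Require Import all_classical all_reals all_analysis.
From mathcomp Require Import ring lra zify.
Import Order.TTheory GRing.Theory Num.Theory.
Import numFieldNormedType.Exports.
Local Open Scope classical_set_scope.
Local Open Scope ring_scope.

Set Implicit Arguments.
Unset Strict Implicit.
Unset Printing Implicit Defensive.

(** In the coordinates [c = x *m T] the cone [V1] becomes the forward light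
    cone of the Lorentz form [H], and the pairing of [x] with [d] becomes the
    Euclidean pairing of [c] with [d *m invmx T^T]. The group [O(H)] moves
    every timelike vector onto the time axis, so that each [x] in [V1] has a
    frame [T'] of its own, with [T' *m H *m T'^T = A], in which [x] is a
    multiple [s] of the first basis vector and [s ^+ 2 = - x A x^T]
    ([coneV1_frame]).

    The only arithmetic estimate is [short_lattice_point]: there is a constant
    [C], the same for all [x] in [V1], and a vector [d] of [D] with [sigma x d
    ^+ 2 <= C * - x A x^T]. In the frame of [x], Minkowski's theorem on linear
    forms provides a nonzero integral vector in a cylinder around the time
    axis, of small fixed radius and large fixed height. The inverse form of [A]
    takes values in [1 / det A] times the integers, and its value on a vector
    of the cylinder is less than [1 / |det A|]; hence it is at most 0, and the
    vector or its opposite lies in [D].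

    If [x] is perfect with minimum 1, the estimate gives [- x A x^T >= 1 / C].
    The minimal vectors of [x] all lie in the light cone and pair to 1 with
    [x], so their mutual products for the inverse form of [A] are bounded
    ([gram_bound]). Choose a basis [B] of integral minimal vectors. Its Gram
    matrix [G] for the integral form [\adj A] takes finitely many values, and
    two bases with the same [G] that agree modulo [\det G] differ by a
    unimodular isometry [g] ([congruent_bases]). As [x] is the solution of [x
    B^T = (1,..,1)], the transpose of [g] carries one perfect point to the
    other, and as it preserves [A] and maps a point of [V1] into [V1], it
    preserves [V1]. So there are finitely many classes of perfect points
    ([finite_perfect_classes]).

    A neighbour of [x] is determined by the minimal vectors that it shares with
    [x] ([adjacent_inj]), and [x] has finitely many minimal vectors, so each
    vertex has finite degree. With the equivariance of the graph this bounds
    the edges modulo the group.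

    Perfect points exist since the estimate also keeps the polyhedron of all
    [x] with [sigma x d >= 1] on [D] away from the boundary of the cone: its
    slices of bounded height are compact, and a vertex of a lowest face is
    perfect ([exists_perfect]).

    The procedure keeps pairwise inequivalent perfect points in [L1] and [L2],
    and each passage through its loop puts a new class into [L2]; this can
    happen only finitely often, and no step gets stuck ([voronoi_terminates]).
    *)

(** * Minkowski's theorem on linear forms *)

Lemma cvg_sum_seq (R : realType) (U I : Type) (F : set_system U) {FF : Filter F}
    (s : seq I) (f : I -> U -> R) (l : I -> R) :
  (forall i, f i u @[u --> F] --> l i) ->
  \sum_(i <- s) f i u @[u --> F] --> \sum_(i <- s) l i.
Proof.
move=> fl; elim: s => [|i s IH].
  rewrite big_nil; under eq_fun do rewrite big_nil; exact: cvg_cst.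
by rewrite big_cons; under eq_fun do rewrite big_cons; apply: cvgD.
Qed.

Lemma cvg_prod_seq (R : realType) (U I : Type) (F : set_system U)
    {FF : Filter F} (s : seq I) (f : I -> U -> R) (l : I -> R) :
  (forall i, f i u @[u --> F] --> l i) ->
  \prod_(i <- s) f i u @[u --> F] --> \prod_(i <- s) l i.
Proof.
move=> fl; elim: s => [|i s IH].
  rewrite big_nil; under eq_fun do rewrite big_nil; exact: cvg_cst.
by rewrite big_cons; under eq_fun do rewrite big_cons; apply: cvgM.
Qed.

Lemma cvg_det (R : realType) (U : Type) (F : set_system U) {FF : Filter F} m
    (f : U -> 'M[R]_m) (l : 'M[R]_m) :
  (forall i j, f u i j @[u --> F] --> l i j) ->
  \det (f u) @[u --> F] --> \det l.
Proof.
move=> fl; apply: cvg_sum_seq => s; apply: cvgM; first exact: cvg_cst.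
by apply: cvg_prod_seq => i.
Qed.

Lemma modz_eq_subr (a b d : int) : d != 0 -> modz a d = modz b d ->
  exists q, a - b = q * d.
Proof.
move=> d0 e; exists ((a %/ d)%Z - (b %/ d)%Z).
by rewrite {1}(divz_eq a d) {1}(divz_eq b d) e; ring.
Qed.

(** Minkowski's theorem for an integral matrix, by counting: the Smith normal
    form shows that the lattice spanned by the rows of [M] has index [|det M|],
    so two of the [k.+1 ^ m] points of the box are congruent modulo the
    lattice. *)
Lemma small_row_combination m (M : 'M[int]_m) (k : nat) : \det M != 0 ->
  (`|\det M| < k.+1 ^ m)%N ->
  exists z : 'rV[int]_m, z != 0 /\ forall j, (absz ((z *m M) 0 j)%R <= k)%N.
Proof.
move=> M0 Mk; have [L Lu [Q Qu [d _ eM]]] := int_Smith_normal_form M.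
pose dd (i : 'I_m) : int := d`_i.
pose E := \matrix_(i < m, j < m) (dd i *+ (i == j :> nat)) : 'M[int]_m.
have eE : E = diag_mx (\row_i dd i).
  by apply/matrixP => i j; rewrite !mxE -val_eqE.
have absu (X : 'M[int]_m) : X \in unitmx -> (`|\det X| = 1)%N.
  by rewrite unitmxE => /unitrP [y [yX Xy]]; move: Xy => /(congr1 absz);
    rewrite abszM => /eqP; rewrite muln_eq1 => /andP[/eqP-> _].
have dM : (`|\det M| = \prod_(i < m) absz (dd i))%N.
  rewrite eM -/E !det_mulmx !abszM (absu L) // (absu Q) // mul1n muln1 eE det_diag.
  rewrite (big_morph absz abszM (erefl : absz 1 = 1%N)).
  by apply: eq_bigr => i _; rewrite !mxE.
have d0 i : dd i != 0.
  have: (0 < \prod_(i < m) absz (dd i))%N by rewrite -dM absz_gt0.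
  by rewrite (bigD1 i) //= muln_gt0 absz_gt0 => /andP[].
(* [W] only serves to house all residues in one ordinal type. *)
pose W := (\sum_(i < m) absz (dd i))%N.
pose vecof (f : {ffun 'I_m -> 'I_k.+1}) : 'rV[int]_m := \row_i (f i)%:Z.
pose res f : {ffun 'I_m -> 'I_W.+1} :=
  [ffun i => inord (absz (modz ((vecof f *m invmx Q) 0 i)%R (dd i)))].
pose Fam i := [pred r : 'I_W.+1 | (r < absz (dd i))%N].
have modlt a (i : 'I_m) : (`|(a %% (dd i))%Z| < absz (dd i))%N.
  by rewrite -ltz_nat gez0_abs ?modz_ge0 ?d0 // ltz_mod.
have leW (i : 'I_m) : (absz (dd i) <= W)%N by rewrite /W (bigD1 i) //= leq_addr.
have resE f i : val (res f i) = absz (modz ((vecof f *m invmx Q) 0 i)%R (dd i)).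
  by rewrite ffunE /= inordK // (leq_trans (modlt _ _)) // ltnW // ltnS.
have resF f : res f \in family Fam.
  by apply/familyP => i; rewrite inE resE modlt.
have cF : (#|family Fam| <= `|\det M|)%N.
  rewrite card_family dM foldrE big_map big_enum /=.
  apply: leq_prod => i _.
  have h (r : 'I_W.+1) : r \in Fam i -> (r < absz (dd i))%N by rewrite inE.
  have d0' : (0 < absz (dd i))%N by rewrite absz_gt0.
  pose g (r : 'I_W.+1) : 'I_(absz (dd i)) := insubd (Ordinal d0') (val r).
  rewrite -[leqRHS]card_ord.
  apply: (@leq_card_in _ _ g) => r s hr hs /(congr1 val).
  rewrite unfold_in in hr; rewrite unfold_in in hs.
  by rewrite !val_insubd hr hs => /val_inj.
have : ~ injective res.
  move=> ri; have: (#|[set res f | f : {ffun 'I_m -> 'I_k.+1}]%SET|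
      <= #|family Fam|)%N.
    by apply: subset_leq_card; apply/fintype.subsetP => _ /imsetP[f _ ->].
  rewrite card_imset // card_ffun !card_ord => h.
  by move: (leq_ltn_trans (leq_trans h cF) Mk); rewrite ltnn.
move=> /injectiveP /injectivePn [f [g fg rfg]].
pose v := vecof f - vecof g.
have hv i : exists q, (v *m invmx Q) 0 i = q * dd i.
  have -> : (v *m invmx Q) 0 i
      = (vecof f *m invmx Q) 0 i - (vecof g *m invmx Q) 0 i.
    by rewrite mulmxBl !mxE.
  apply: modz_eq_subr => //;
    have : val (res f i) = val (res g i) by rewrite rfg.
  rewrite !resE => /(congr1 Posz).
  by rewrite !gez0_abs ?modz_ge0.
pose u : 'rV[int]_m := \row_i projT1 (cid (hv i)).
have uE : u *m E = v *m invmx Q.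
  apply/rowP => i; rewrite eE mul_mx_diag mxE [X in _ * X]mxE [u _ _]mxE.
  by case: cid.
exists (u *m invmx L).
have zM : u *m invmx L *m M = v.
  by rewrite eM -/E !mulmxA mulmxKV // uE mulmxKV.
split=> [|j].
  apply: contra_neq fg => u0; move: zM; rewrite u0 mul0mx => v0.
  apply/ffunP => i; apply: val_inj; have := congr1 (fun w : 'rV_m => w 0 i) v0.
  by rewrite /v !mxE => /esym/eqP; rewrite subr_eq0 => /eqP[].
rewrite zM /v !mxE; move: (f j) (g j) => [p hp] [q hq] /=.
set r := (X in absz X); have -> : r = p%:Z - q%:Z by [].
clear -hp hq; lia.
Qed.

Lemma ler_norm_mulmx_coord (R : realType) m p
    (w : 'rV[R]_m) (B : 'M[R]_(m, p)) j :
  `|(w *m B) 0 j| <= (\sum_i `|w 0 i|) * \sum_i \sum_l `|B i l|.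
Proof.
rewrite mxE (le_trans (ler_norm_sum _ _ _)) // mulr_suml ler_sum // => i _.
rewrite normrM ler_wpM2l // (bigD1 i) //= (bigD1 j) //= -addrA lerDl.
by rewrite addr_ge0 // sumr_ge0 // => *; rewrite sumr_ge0.
Qed.

(** Minkowski's theorem with the bound 2 instead of 1: rounding [k * L] to an
    integral matrix for a large [k] reduces it to the integral case, and the
    rounding error is absorbed by the factor 2. *)
Lemma minkowski_linear_forms (R : realType) m (L : 'M[R]_m) :
  L \in unitmx -> `|\det L| < 1 ->
  exists z : 'rV[int]_m, z != 0 /\ forall j, `|(int_mx R z *m L) 0 j| <= 2.
Proof.
move=> Lu L1.
pose M (k : nat) : 'M[int]_m := map_mx (fun a => Num.floor (k.+1%:R * a)) L.
pose D k : 'M[R]_m := k.+1%:R^-1 *: int_mx R (M k).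
have k0 k : (0 : R) < k.+1%:R by [].
have DL k i j : L i j - k.+1%:R^-1 <= D k i j <= L i j.
  rewrite !mxE.
  have /andP[h1 h2] := real_floor_itv (num_real (k.+1%:R * L i j)).
  apply/andP; split.
    rewrite -(ler_pM2l (k0 k)) mulrBr mulrA !divff ?gt_eqF // mul1r.
    by move: h2; rewrite intrD; lra.
  by rewrite mulrC ler_pdivrMr // [leRHS]mulrC.
have cD i j : D k i j @[k --> \oo] --> L i j.
  apply: (@squeeze_cvgr _ _ _ _ (fun k => L i j - k.+1%:R^-1) (fun=> L i j)).
  - by apply: nearW => k; apply: DL.
  - rewrite -[X in _ --> X]subr0; apply: cvgB; first exact: cvg_cst.
    exact: cvg_harmonic.
  - exact: cvg_cst.
have cdet : \det (D k) @[k --> \oo] --> \det L by exact: cvg_det cD.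
pose c := \sum_i \sum_l `|(invmx L) i l|.
have c0 : 0 <= c by rewrite sumr_ge0 // => *; rewrite sumr_ge0.
have detL0 : 0 < `|\det L| by rewrite normr_gt0 -unitfE -unitmxE.
have /filter_ex[k [[kn kl] kc]] : \forall k \near \oo,
    (0 < `|\det (D k)| /\ `|\det (D k)| < 1) /\ 2 * m%:R ^+ 2 * c <= k.+1%:R.
  have cn : `|\det (D k)| @[k --> \oo] --> `|\det L| by apply: cvg_norm.
  near=> k; split; first split.
  - by near: k; apply: (cvgr_gt _ cn).
  - by near: k; apply: (cvgr_lt _ cn).
  - apply: le_trans (_ : k%:R <= _); last by rewrite ler_nat.
    by near: k; apply: nbhs_infty_ger.
have detD : \det (D k) = k.+1%:R^-1 ^+ m * (\det (M k))%:~R.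
  by rewrite /D detZ /int_mx det_map_mx.
have [||z [z0 zk]] := @small_row_combination m (M k) k.
- by apply: contraTneq kn => e; rewrite detD e mulr0 normr0 ltxx.
- rewrite -(ltr_nat R) natr_absz natrX intr_norm.
  move: kl; rewrite detD normrM exprVn [X in X * _]ger0_norm.
    by rewrite mulrC ltr_pdivrMr ?exprn_gt0 // mul1r.
  by rewrite invr_ge0 exprn_ge0.
exists z; split=> //.
(* [z] itself is controlled by [w] through [invmx L], so that the error made in
   replacing [D k] by [L] is at most half of the size of [w]. *)
pose w := int_mx R z *m L.
pose W := \sum_j `|w 0 j|.
have zE : int_mx R z = w *m invmx L by rewrite /w mulmxK.
have zW i : `|(int_mx R z) 0 i| <= W * c.
  by rewrite zE; exact: ler_norm_mulmx_coord.
have zD j : `|(int_mx R z *m D k) 0 j| <= 1.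
  rewrite /D -scalemxAr mxE normrM normfV (ger0_norm (ltW (k0 k))) mulrC ler_pdivrMr //.
  rewrite mul1r /int_mx -map_mxM mxE -intr_norm -abszE -pmulrn ler_nat.
  exact: leq_trans (zk j) _.
have wj j : `|w 0 j| <= 1 + m%:R * (W * c) / k.+1%:R.
  have -> : w = int_mx R z *m D k + int_mx R z *m (L - D k).
    by rewrite -mulmxDr addrC subrK.
  rewrite mxE (le_trans (ler_normD _ _)) // lerD // mxE.
  rewrite (le_trans (ler_norm_sum _ _ _)) //.
  have -> : m%:R * (W * c) / k.+1%:R = \sum_(i < m) (W * c) / k.+1%:R.
    by rewrite sumr_const card_ord -mulr_natl; ring.
  rewrite ler_sum // => i _; rewrite normrM ler_pM ?zW //.
  have /andP[h1 h2] := DL k i j.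
  have -> : (L - D k) i j = L i j - D k i j 
    by rewrite [LHS]mxE [(- D k) _ _]mxE.
  move: h1 h2; move: (D k i j) (L i j) (k.+1%:R^-1) => p q r h1 h2.
  by rewrite ger0_norm; lra.
have W0 : 0 <= W by rewrite sumr_ge0.
have WW : W <= m%:R + m%:R ^+ 2 * c * W / k.+1%:R.
  have -> : m%:R + m%:R ^+ 2 * c * W / k.+1%:R
      = \sum_(i < m) (1 + m%:R * (W * c) / k.+1%:R).
    by rewrite sumr_const card_ord -mulr_natl; ring.
  exact: ler_sum.
have hW : m%:R ^+ 2 * c * W / k.+1%:R <= W / 2.
  rewrite ler_pdivrMr //; have := ler_wpM2l W0 kc; lra.
have W2 : W <= 2 * m%:R by clearbody W; move: WW hW; move: (_ / k.+1%:R) => q;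
  lra.
move=> j; apply: le_trans (wj j) _.
suff : m%:R * (W * c) / k.+1%:R <= 1 by move: (_ / _) => q; lra.
rewrite ler_pdivrMr // mul1r (le_trans _ kc) //.
by rewrite [leRHS](_ : _ = m%:R * (2 * m%:R * c));
  [rewrite ler_wpM2l // ler_wpM2r|ring].
Unshelve. all: by end_near.
Qed.

(** * The light cone *)

Section Lorentz.
Variables (R : realType) (n : nat).
Local Notation vec := 'rV[R]_n.+1.
Local Notation H := (Hmx R n).
Implicit Types (x y c w : vec).

Definition spdot x y : R := \sum_(i < n) x 0 (lift ord0 i) * y 0 (lift ord0 i).

Definition closed_cone : set vec := [set c | quad H c <= 0 /\ 0 <= c 0 0].

Lemma sigmaE x y : sigma x y = \sum_i x 0 i * y 0 i.
Proof. by rewrite /sigma mxE; apply: eq_bigr => i _; rewrite mxE. Qed.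

Lemma sigmaC x y : sigma x y = sigma y x.
Proof. by rewrite !sigmaE; apply: eq_bigr => i _; rewrite mulrC. Qed.

Lemma sigmaDl x y z : sigma (x + y) z = sigma x z + sigma y z.
Proof. by rewrite /sigma mulmxDl mxE. Qed.

Lemma sigmaNl x z : sigma (- x) z = - sigma x z.
Proof. by rewrite /sigma mulNmx mxE. Qed.

Lemma sigmaBl x y z : sigma (x - y) z = sigma x z - sigma y z.
Proof. by rewrite sigmaDl sigmaNl. Qed.

Lemma sigmaZl a x z : sigma (a *: x) z = a * sigma x z.
Proof. by rewrite /sigma -scalemxAl mxE. Qed.

Lemma sigmaDr x y z : sigma z (x + y) = sigma z x + sigma z y.
Proof. by rewrite !(sigmaC z) sigmaDl. Qed.

Lemma sigmaNr x z : sigma z (- x) = - sigma z x.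
Proof. by rewrite !(sigmaC z) sigmaNl. Qed.

Lemma sigmaZr a x z : sigma z (a *: x) = a * sigma z x.
Proof. by rewrite !(sigmaC z) sigmaZl. Qed.

Lemma sigma_mulmx (B : 'M[R]_n.+1) x y : sigma (x *m B) y = sigma x (y *m B^T).
Proof. by rewrite /sigma trmx_mul trmxK mulmxA. Qed.

Lemma quadE (B : 'M[R]_n.+1) x : quad B x = sigma (x *m B) x.
Proof. by []. Qed.

Lemma quad_mulmx (B C : 'M[R]_n.+1) x : 
  quad B (x *m C) = quad (C *m B *m C^T) x.
Proof. by rewrite /quad trmx_mul !mulmxA. Qed.

Lemma sigma_time x y : sigma x y = x 0 0 * y 0 0 + spdot x y.
Proof. by rewrite sigmaE big_ord_recl. Qed.

Lemma Hmx_sym : H^T = H.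
Proof. by rewrite tr_diag_mx. Qed.

Lemma Hmx_sqr : H *m H = 1%:M.
Proof.
rewrite /Hmx mulmx_diag; apply/matrixP => i j; rewrite !mxE.
by case: (i == ord0); rewrite ?mulrNN mulr1.
Qed.

Lemma lorE x y : sigma (x *m H) y = - (x 0 0 * y 0 0) + spdot x y.
Proof.
rewrite sigma_time /Hmx mul_mx_diag !mxE eqxx mulrN1 mulNr; congr (_ + _).
by apply: eq_bigr => i _; rewrite !mxE /= mulr1.
Qed.

Lemma quadHE x : quad H x = - (x 0 0 ^+ 2) + spdot x x.
Proof. by rewrite quadE lorE expr2. Qed.

Lemma spdot_ge0 x : 0 <= spdot x x.
Proof. by apply: sumr_ge0 => i _; rewrite -expr2 sqr_ge0. Qed.

Lemma spdot_eq0 x : spdot x x <= 0 -> forall i, x 0 (lift ord0 i) = 0.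
Proof.
move=> hx i; have : spdot x x == 0 by rewrite eq_le hx spdot_ge0.
rewrite psumr_eq0 => [/allP /(_ i)|j _]; last by rewrite -expr2 sqr_ge0.
by rewrite mem_index_enum mulf_eq0 orbb => /(_ isT)/eqP.
Qed.

(** A division-free Cauchy-Schwarz inequality, summing [0 <= (b * x_i -+ a *
    y_i) ^+ 2]. *)
Lemma spdot_amgm (a b : R) x y :
  2 * (a * b) * `|spdot x y| <= b ^+ 2 * spdot x x + a ^+ 2 * spdot y y.
Proof.
have h (e : R) : e ^+ 2 = 1 ->
    2 * (a * b) * (e * spdot x y) <= b ^+ 2 * spdot x x + a ^+ 2 * spdot y y.
  move=> e1; rewrite /spdot !mulr_sumr -big_split /= ler_sum // => i _.
  move: (x _ _) (y _ _) => p q.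
  have : 0 <= (b * p - e * a * q) ^+ 2 by rewrite sqr_ge0.
  have -> : (b * p - e * a * q) ^+ 2 =
    b ^+ 2 * p ^+ 2 + e ^+ 2 * (a ^+ 2 * q ^+ 2) - 2 * (a * b) * (e * (p * q)).
    by ring.
  by rewrite e1; lra.
case: (ger0P (spdot x y)) => s.
  by have := h 1; rewrite mul1r expr1n; apply.
by have := h (-1); rewrite mulN1r sqrrN expr1n; apply.
Qed.

Lemma spdot_le (a b : R) x y : 0 <= a -> 0 <= b ->
  spdot x x <= a ^+ 2 -> spdot y y <= b ^+ 2 -> `|spdot x y| <= a * b.
Proof.
move=> a0 b0 hx hy; have h := spdot_amgm a b x y.
have [ab|] := ltrP 0 (a * b).
  have h1 := ler_wpM2l (sqr_ge0 b) hx; have h2 := ler_wpM2l (sqr_ge0 a) hy.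
  rewrite -(ler_pM2l ab); apply: le_trans (_ : (b ^+ 2 * a ^+ 2 + a ^+ 2 * b ^+ 2) / 2 <= _); lra.
move=> ab; have {ab}ab : a * b = 0 by apply/eqP; rewrite eq_le ab mulr_ge0.
rewrite ab; move/eqP: ab; rewrite mulf_eq0 => /orP[]/eqP e.
  by rewrite /spdot big1 ?normr0 // => i _;
    rewrite spdot_eq0 ?mul0r // (le_trans hx) // e expr0n.
by rewrite /spdot big1 ?normr0 // => i _;
  rewrite (@spdot_eq0 y) ?mulr0 // (le_trans hy) // e expr0n.
Qed.

Lemma coneC_closed c : coneC c -> closed_cone c.
Proof. by case=> h1 h2; split; apply: ltW. Qed.

Lemma closed_cone_time c : closed_cone c -> c != 0 -> 0 < c 0 0.
Proof.
case=> q c0 cn; rewrite lt_neqAle c0 andbT eq_sym; apply: contra_neq cn => e.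
have hs : spdot c c <= 0 by move: q; rewrite quadHE e expr0n /= oppr0 add0r.
apply/rowP => i; rewrite mxE.
by case: (unliftP ord0 i) => [j|] -> //; apply: spdot_eq0.
Qed.

Lemma closed_cone_spdot c : closed_cone c -> spdot c c <= (c 0 0) ^+ 2.
Proof. by case; rewrite quadHE; lra. Qed.

Lemma coneC_time c : coneC c -> 0 < c 0 0.
Proof. by case. Qed.

(** Cauchy-Schwarz on the spatial parts, where the time coordinates dominate.
    *)
Lemma spdot_lt c w : coneC c -> closed_cone w -> w != 0 ->
  `|spdot c w| < c 0 0 * w 0 0.
Proof.
move=> hc hw w0; have t0 := closed_cone_time hw w0.
case: hc; rewrite quadHE => q c0; have hs := closed_cone_spdot hw.
have h := spdot_amgm (c 0 0) (w 0 0) c w.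
have cw : 0 < c 0 0 * w 0 0 by rewrite mulr_gt0.
rewrite -(ltr_pM2l cw).
have w2 : 0 < w 0 0 ^+ 2 by rewrite exprn_gt0.
have hq : spdot c c < c 0 0 ^+ 2 by lra.
have h1 : w 0 0 ^+ 2 * spdot c c < w 0 0 ^+ 2 * c 0 0 ^+ 2 by rewrite ltr_pM2l.
have h2 := ler_wpM2l (sqr_ge0 (c 0 0)) hs.
lra.
Qed.

Lemma cone_pair_gt0 c w : coneC c -> closed_cone w -> w != 0 -> 0 < sigma c w.
Proof.
move=> hc hw w0; rewrite sigma_time.
by have := spdot_lt hc hw w0; rewrite ltr_norml => /andP[]; lra.
Qed.

Lemma cone_pair_ge0 c w : coneC c -> closed_cone w -> 0 <= sigma c w.
Proof.
move=> hc hw; have [->|w0] := eqVneq w 0; last exact/ltW/cone_pair_gt0.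
by rewrite /sigma trmx0 mulmx0 mxE.
Qed.

(** The cone is self-dual: a vector outside pairs negatively with a timelike
    vector whose spatial part points the opposite way. *)
Lemma closed_cone_dual w : (forall c, coneC c -> 0 <= sigma c w) ->
  closed_cone w.
Proof.
move=> h.
pose mk t a : vec := \row_i (if i == ord0 then t else a * w 0 i).
have mk0 t a : mk t a 0 0 = t by rewrite mxE eqxx.
have mks t a y : spdot (mk t a) y = a * spdot w y.
  by rewrite /spdot mulr_sumr; apply: eq_bigr => i _; rewrite mxE /= mulrA.
have spC y z : spdot y z = spdot z y.
  by apply: eq_bigr => i _; rewrite mulrC.
have mkC t a : a ^+ 2 * spdot w w < t ^+ 2 -> 0 < t -> coneC (mk t a).
  move=> q t0; split; last by rewrite mk0.
  by rewrite quadHE mk0 mks spC mks; lra.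
have w0 : 0 <= w 0 0.
  have /h : coneC (mk 1 0) by apply: mkC; lra.
  by rewrite sigma_time mk0 mks; lra.
split=> //; rewrite quadHE; have s0 := spdot_ge0 w.
have [//|lt] := lerP (- w 0 0 ^+ 2 + spdot w w) 0.
pose s := Num.sqrt (spdot w w);
  have s2 : s ^+ 2 = spdot w w by rewrite sqr_sqrtr.
have ws : w 0 0 < s.
  rewrite -ltr_sqr ?nnegrE ?sqrtr_ge0 // s2; lra.
have sp : 0 < w 0 0 + s by lra.
(* Any [t] between [s] and [s ^+ 2 / w 0 0] would do; this harmonic mean makes
   sense even if [w 0 0] is 0. *)
pose t := 2 * s ^+ 2 / (w 0 0 + s).
have st : s < t.
  rewrite ltr_pdivlMr // ; have : 0 < s * (s - w 0 0) by rewrite mulr_gt0; lra.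
  lra.
have /h : coneC (mk t (-1)).
  apply: mkC; last lra.
  by rewrite sqrrN expr1n mul1r -s2 ltr_sqr ?nnegrE //; lra.
rewrite sigma_time mk0 mks -s2 leNgt; have -> // : t * w 0 0 + -1 * s ^+ 2 < 0.
rewrite mulN1r subr_lt0 /t mulrAC ltr_pdivrMr //.
have : 0 < s ^+ 2 * (s - w 0 0) by rewrite mulr_gt0 ?exprn_gt0; lra.
lra.
Qed.

Lemma cone_lor_lt0 c w : coneC c -> coneC w -> sigma (c *m H) w < 0.
Proof.
move=> hc hw; rewrite lorE.
have w0 : w != 0.
  by apply: contraTneq (coneC_time hw) => ->; rewrite mxE ltxx.
by have := spdot_lt hc (coneC_closed hw) w0; rewrite ltr_norml => /andP[]; lra.
Qed.

(** Otherwise its opposite would be a future vector, and two future vectors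
    have a negative Lorentz product. *)
Lemma coneC_lor c w : coneC c -> quad H w < 0 -> sigma (c *m H) w < 0 ->
  coneC w.
Proof.
move=> hc qw s; split=> //; rewrite ltNge; apply/negP => w0.
have qN : quad H (- w) = quad H w by rewrite !quadE mulNmx sigmaNl sigmaNr opprK.
have wN : coneC (- w).
  split; first by rewrite qN.
  rewrite mxE oppr_gt0 lt_neqAle w0 andbT; apply: contraTneq qw => e.
  by rewrite quadHE e expr0n /= oppr0 add0r -leNgt spdot_ge0.
by have := cone_lor_lt0 hc wN; rewrite sigmaNr; lra.
Qed.
End Lorentz.
(** * Lorentz frames and the dual cones *)

Section Frames.
Variables (R : realType) (n : nat).
Local Notation vec := 'rV[R]_n.+1.
Local Notation H := (Hmx R n).
Local Notation e0 := (delta_mx 0 0 : vec).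
Implicit Types (x y d u w : vec).

Lemma spdot_e0 y : spdot y e0 = 0.
Proof. by rewrite /spdot big1 // => i _; rewrite [X in _ * X]mxE /= mulr0. Qed.

Lemma sigma_e0 y : sigma y e0 = y 0 0.
Proof. by rewrite sigma_time spdot_e0 mxE /= mulr1 addr0. Qed.

Lemma lor_e0 y : sigma (y *m H) e0 = - y 0 0.
Proof. by rewrite lorE spdot_e0 mxE /= mulr1 addr0. Qed.

Lemma lorC x y : sigma (x *m H) y = sigma (y *m H) x.
Proof. by rewrite sigma_mulmx Hmx_sym sigmaC. Qed.

Lemma coneC_e0 : coneC e0.
Proof. by split; rewrite ?quadE ?lor_e0 mxE /= ?oppr_lt0 ltr01. Qed.

Lemma mulmx_rank1 y u : y *m (H *m u^T *m u) = sigma (y *m H) u *: u.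
Proof. by rewrite !mulmxA [y *m H *m u^T]mx11_scalar mul_scalar_mx. Qed.

(** The Lorentz reflection in the timelike vector [w + e0] sends [w] to [- e0],
    so its opposite is an isometry moving [w] to the first basis vector. *)
Lemma lor_reflection w : coneC w -> quad H w = -1 ->
  exists P : 'M[R]_n.+1, P *m H *m P^T = H /\ w *m P = e0.
Proof.
move=> wC w1; pose u : vec := w + e0; have w0 := coneC_time wC.
have wu : sigma (w *m H) u = -1 - w 0 0 by rewrite sigmaDr lor_e0 -quadE w1.
have uu : sigma (u *m H) u = 2 * (-1 - w 0 0).
  rewrite {1}/u mulmxDl sigmaDl wu sigmaDr -(lorC w) !lor_e0 mxE /=; ring.
pose k := 2 / sigma (u *m H) u.
have uu0 : sigma (u *m H) u != 0 by rewrite uu; apply/negP => /eqP; lra.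
have kuu : k * sigma (u *m H) u = 2 by rewrite divfK.
have kwu : k * sigma (w *m H) u = 1.
  apply: (mulfI uu0); rewrite mulrA [_ * k]mulrC kuu wu uu; ring.
exists (k *: (H *m u^T *m u) - 1%:M); split; last first.
  by rewrite mulmxBr mulmx1 -scalemxAr mulmx_rank1 scalerA kwu scale1r addrC addKr.
pose M := H *m u^T *m (u *m H).
have NT : (H *m u^T *m u)^T = u^T *m (u *m H).
  by rewrite trmx_mul trmx_mul trmxK Hmx_sym.
have E1 : H *m u^T *m u *m H = M by rewrite /M !mulmxA.
have E2 : H *m (u^T *m (u *m H)) = M by rewrite /M !mulmxA.
have E3 : M *m (u^T *m (u *m H)) = sigma (u *m H) u *: M.
  rewrite /M mulmxA -[_ *m (u *m H) *m u^T]mulmxA [u *m H *m u^T]mx11_scalar.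
  by rewrite -/(sigma _ _) mul_mx_scalar -scalemxAl.
rewrite linearB /= linearZ /= NT trmx1 mulmxBl mulmxBr -!scalemxAl mul1mx.
rewrite !mulmx1 E1 mulmxBl -!scalemxAl -!scalemxAr E3 E2 !scalerA.
rewrite -mulrA kuu; apply/matrixP => i j; rewrite !mxE; ring.
Qed.

Lemma quad_continuous (B : 'M[R]_n.+1) : continuous (quad B : vec -> R).
Proof.
move=> x; rewrite /continuous_at /quad.
have -> : (fun y : vec => (y *m B *m y^T) 0 0)
    = fun y => \sum_i (\sum_j y 0 j * B j i) * y 0 i.
  by apply/funext => y; rewrite mxE; apply: eq_bigr => i _; rewrite !mxE.
rewrite [X in _ --> X](_ : _ = \sum_i (\sum_j x 0 j * B j i) * x 0 i);
  last first.
  by rewrite mxE; apply: eq_bigr => i _; rewrite !mxE.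
apply: (@cvg_sum_seq _ _ _ (nbhs x)) => i; apply: cvgM;
  last exact: coord_continuous.
apply: (@cvg_sum_seq _ _ _ (nbhs x)) => j; apply: cvgM;
  first exact: coord_continuous.
exact: cvg_cst.
Qed.

Lemma sigma_continuous d : continuous (fun y : vec => sigma y d).
Proof.
move=> x; rewrite /continuous_at sigmaE.
under eq_fun do rewrite sigmaE; apply: (@cvg_sum_seq _ _ _ (nbhs x)) => i.
by apply: cvgM; [exact: coord_continuous|exact: cvg_cst].
Qed.

Lemma closed_quad_le (B : 'M[R]_n.+1) a : closed [set y : vec | quad B y <= a].
Proof.
have h := (iffLR (continuous_closedP _)) (@quad_continuous B).
by have := h _ (@closed_le R a).
Qed.

Lemma closed_sigma_ge d a : closed [set y : vec | a <= sigma y d].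
Proof.
have h := (iffLR (continuous_closedP _)) (@sigma_continuous d).
by have := h _ (@closed_ge R a).
Qed.

Lemma closed_sigma_le d a : closed [set y : vec | sigma y d <= a].
Proof.
have h := (iffLR (continuous_closedP _)) (@sigma_continuous d).
by have := h _ (@closed_le R a).
Qed.

Variable T : 'M[R]_n.+1.
Hypothesis T_unit : T \in unitmx.
Local Notation A := (T *m H *m T^T).

Lemma coneV1P x : coneV1 T x <-> coneC (x *m T).
Proof.
split=> [[c hc <-]|hx]; first by rewrite mulmxKV.
by exists (x *m T); rewrite ?mulmxK.
Qed.

Lemma quadA x : quad A x = quad H (x *m T).
Proof. by rewrite quad_mulmx. Qed.

Lemma coneV1_quad x : coneV1 T x -> quad A x < 0.
Proof. by move/coneV1P => [q _]; rewrite quadA. Qed.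

Lemma coneV1_neg x y : coneV1 T x -> coneV1 T y -> sigma (x *m A) y < 0.
Proof.
move=> /coneV1P hx /coneV1P hy; rewrite !mulmxA sigma_mulmx trmxK.
exact: cone_lor_lt0.
Qed.

Lemma coneV1_of_neg x y : coneV1 T x -> quad A y < 0 -> sigma (x *m A) y < 0 ->
  coneV1 T y.
Proof.
move=> /coneV1P hx qy; rewrite !mulmxA sigma_mulmx trmxK => s.
by apply/coneV1P; apply: coneC_lor s; rewrite -?quadA.
Qed.

Lemma coneV1D x y : coneV1 T x -> coneV1 T y -> coneV1 T (x + y).
Proof.
move=> hx hy; apply: (coneV1_of_neg hx).
  rewrite quadE mulmxDl sigmaDl !sigmaDr -!quadE.
  have := coneV1_neg hx hy; have := coneV1_neg hy hx.
  by have := coneV1_quad hx; have := coneV1_quad hy; lra.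
rewrite sigmaDr -quadE.
by have := coneV1_neg hx hy; have := coneV1_quad hx; lra.
Qed.

Lemma coneV1Z a x : 0 < a -> coneV1 T x -> coneV1 T (a *: x).
Proof.
move=> a0 hx; apply: (coneV1_of_neg hx).
  rewrite quadE -scalemxAl sigmaZl sigmaZr -quadE mulrA pmulr_rlt0 ?mulr_gt0 //.
  exact: coneV1_quad.
by rewrite sigmaZr pmulr_rlt0 // -quadE coneV1_quad.
Qed.

(** Openness along lines, by an explicit estimate of the quadratic form. *)
Lemma coneV1_open x r : coneV1 T x ->
  exists2 h, 0 < h & coneV1 T (x + h *: r) /\ coneV1 T (x - h *: r).
Proof.
move=> hx; pose q := - quad A x;
  have q0 : 0 < q by rewrite oppr_gt0 coneV1_quad.
pose b := `|sigma (x *m A) r| + `|sigma (r *m A) x| + `|quad A r|.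
have b0 : 0 <= b by rewrite !addr_ge0.
pose h := q / (q + b); have qb : 0 < q + b by lra.
have h0 : 0 < h by rewrite divr_gt0.
have h1 : h <= 1 by rewrite ler_pdivrMr // mul1r; lra.
have hb : h * b < q.
  rewrite /h mulrAC ltr_pdivrMr // ltr_pM2l //; lra.
have key e : e ^+ 2 = 1 -> `|e| = 1 -> coneV1 T (x + (e * h) *: r).
  move=> e2 e1; have bd t a : `|t| <= a -> e * t <= a /\ - a <= e * t.
    move=> ta; have : `|e * t| <= a by rewrite normrM e1 mul1r.
    by rewrite ler_norml => /andP[].
  have [p1 p2] := bd _ _ (lexx `|sigma (x *m A) r|).
  have [p3 p4] := bd _ _ (lexx `|sigma (r *m A) x|).
  have := ler_norm (quad A r); set Q := quad A r => Q1.
  have aQ := normr_ge0 Q; have a1 := normr_ge0 (sigma (x *m A) r).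
  have a2 := normr_ge0 (sigma (r *m A) x).
  apply: (coneV1_of_neg hx).
    rewrite quadE mulmxDl sigmaDl !sigmaDr -!scalemxAl !sigmaZl !sigmaZr -!quadE.
    have -> : e * h * (e * h * quad A r) = h * (h * Q) * e ^+ 2 by rewrite /Q;
      ring.
    rewrite e2 mulr1.
    have hQ : h * (h * Q) <= h * `|Q|.
      rewrite (ler_wpM2l (ltW h0)) // (le_trans (ler_wpM2l (ltW h0) Q1)) //.
      by rewrite ler_piMl.
    have := ler_wpM2l (ltW h0) p1; have := ler_wpM2l (ltW h0) p3.
    by move: hb; rewrite /b /q -/Q; lra.
  rewrite sigmaDr sigmaZr -quadE.
  have := ler_wpM2l (ltW h0) p1; have := mulr_ge0 (ltW h0) aQ.
  have := mulr_ge0 (ltW h0) a2; have := mulr_ge0 (ltW h0) a1.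
  by move: hb; rewrite /b /q -/Q; lra.
exists h => //; split; first by have := key 1; rewrite mul1r expr1n normr1;
  exact.
by have := key (-1); rewrite sqrrN expr1n normrN1 mulN1r scaleNr; exact.
Qed.

Lemma sigma_dual x c : sigma x (c *m T^T) = sigma (x *m T) c.
Proof. by rewrite sigma_mulmx. Qed.

Lemma tr_unit : T^T \in unitmx.
Proof. by rewrite unitmx_tr. Qed.

Lemma closure_coneV2 d : closure (coneV2 T) d <-> closed_cone (d *m invmx T^T).
Proof.
pose U := invmx T^T.
split=> [hd|hd].
  have sub : coneV2 T `<=` [set y | quad (U *m H *m U^T) y <= 0]
        `&` [set y | 0 <= sigma y (e0 *m U^T)].
    move=> _ [c [c1 c2] <-]; split; rewrite /= -?quad_mulmx -?sigma_mulmx.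
      by rewrite mulmxK ?tr_unit // ltW.
    by rewrite mulmxK ?tr_unit // sigma_e0 ltW.
  have := closure_subset sub hd.
  rewrite -(closure_id _).1; last first.
    by apply: closedI; [exact: closed_quad_le|exact: closed_sigma_ge].
  by case; rewrite /= -quad_mulmx -sigma_mulmx sigma_e0.
move=> B /nbhs_ballP [e /= e_gt0 Be].
have e00 : e0 0 0 = 1 by rewrite mxE.
pose v := e0 *m T^T; pose t := e / 2 / (`|v| + 1).
have v0 : 0 <= `|v| by [].
have t0 : 0 < t by rewrite !divr_gt0 //; lra.
exists (d + t *: v); split; last first.
  apply: Be; rewrite -ball_normE /= opprD addNKr normrN normrZ gtr0_norm //.
  have ev := mulr_ge0 (ltW e_gt0) v0.
  rewrite /t mulrAC ltr_pdivrMr; lra.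
exists (d *m U + t *: e0); last first.
  by rewrite mulmxDl mulmxKV ?tr_unit // -scalemxAl.
apply: (@coneC_lor _ _ e0 _ coneC_e0); last first.
  rewrite sigmaDr sigmaZr -quadE quadHE spdot_e0 lorC lor_e0 e00.
  by case: hd => _; rewrite -/U; clearbody t; lra.
rewrite quadE mulmxDl sigmaDl !sigmaDr -!scalemxAl !sigmaZl !sigmaZr (lorC e0) !lor_e0.
case: hd; rewrite -/U -quadE e00.
move=> h1 h2; have := mulr_ge0 (ltW t0) h2; have := mulr_gt0 t0 t0;
  clearbody t; lra.
Qed.

(** The description of [D] by duality is the one that is visibly invariant
    under the contragredient action of the group. *)
Lemma closure_coneV2_dual d :
  closure (coneV2 T) d <-> forall x, coneV1 T x -> 0 <= sigma x d.
Proof.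
rewrite closure_coneV2; split=> [hd x /coneV1P hx|h].
  by rewrite -(mulmxKV tr_unit d) sigma_dual; apply: cone_pair_ge0.
apply: closed_cone_dual => c hc; rewrite -[c](mulmxKV T_unit) -sigma_dual.
by rewrite mulmxKV ?tr_unit //; apply: h; exists c.
Qed.

(** Estimates at [x] can be made with [x] on the time axis, whatever the
    position of [x] in the cone. *)
Lemma coneV1_frame x : coneV1 T x -> exists T' (s : R),
  [/\ 0 < s, s ^+ 2 = - quad A x, T' \in unitmx, T' *m H *m T'^T = A
    & x *m T' = s *: e0].
Proof.
move=> hx; have xq := coneV1_quad hx; have /coneV1P cx := hx.
pose s := Num.sqrt (- quad A x).
have s0 : 0 < s by rewrite sqrtr_gt0 oppr_gt0.
have s2 : s ^+ 2 = - quad A x by rewrite sqr_sqrtr // oppr_ge0 ltW.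
have sx : coneV1 T (s^-1 *: x) by apply: coneV1Z; rewrite ?invr_gt0.
have q1 : quad H (s^-1 *: x *m T) = -1.
  rewrite -quadA quadE -scalemxAl sigmaZl sigmaZr -quadE.
  have -> : quad A x = - s ^+ 2 by rewrite s2 opprK.
  by field; rewrite gt_eqF.
have [P [PH wP]] := lor_reflection ((coneV1P _).1 sx) q1.
exists (T *m P), s; split=> //.
- rewrite unitmx_mul T_unit.
  have : P *m (H *m P^T *m H) = 1%:M by rewrite !mulmxA PH Hmx_sqr.
  by case/mulmx1_unit.
- by rewrite -[in RHS]PH trmx_mul !mulmxA.
- by rewrite -wP -scalemxAl -scalemxAl scalerA divff ?gt_eqF // scale1r mulmxA.
Qed.
End Frames.
(** * Short vectors of the lattice *)

Section Lattice.
Variables (R : realType) (n : nat).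
Local Notation vec := 'rV[R]_n.+1.
Local Notation H := (Hmx R n).
Local Notation e0 := (delta_mx 0 0 : vec).
Implicit Types (x y d : vec).

Lemma invmx_frame (T : 'M[R]_n.+1) : T \in unitmx ->
  invmx (T *m H *m T^T) = invmx T^T *m H *m (invmx T^T)^T.
Proof.
move=> Tu; have Tu' := tr_unit Tu.
have E : (invmx T^T *m H *m (invmx T^T)^T) *m (T *m H *m T^T) = 1%:M.
  rewrite trmx_inv trmxK !mulmxA mulmxKV // -(mulmxA _ H H) Hmx_sqr mulmx1.
  by rewrite mulVmx.
have [_ Au] := mulmx1_unit E.
by rewrite -[LHS]mul1mx -E mulmxK.
Qed.

Lemma det_frame (T : 'M[R]_n.+1) : T \in unitmx ->
  `|\det (T *m H *m T^T)| = `|\det T| ^+ 2.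
Proof.
move=> Tu; rewrite !det_mulmx det_tr !normrM.
suff -> : `|\det H| = 1 by rewrite mulr1 expr2.
by have := congr1 (fun M => `|\det M|) (Hmx_sqr R n);
  rewrite det_mulmx det1 normrM normr1 => /eqP;
  rewrite -expr2 sqrp_eq1 // => /eqP.
Qed.

Variables (A : 'M[int]_n.+1) (T : 'M[R]_n.+1).
Hypothesis T_unit : T \in unitmx.
Hypothesis T_A : T *m H *m T^T = int_mx R A.
Local Notation V1 := (coneV1 T).
Local Notation D := (lattice_points (coneV2 T)).
Local Notation qA := (quad (int_mx R A)).
Local Notation qI := (quad (invmx (int_mx R A))).

Lemma intA_unit : int_mx R A \in unitmx.
Proof.
have Hu : H \in unitmx by have /mulmx1_unit[] := Hmx_sqr R n.
by rewrite -T_A !unitmx_mul unitmx_tr T_unit Hu.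
Qed.

Lemma detA_neq0 : \det A != 0.
Proof.
have := intA_unit; rewrite unitmxE unitfE /int_mx det_map_mx.
by apply: contraNneq => ->.
Qed.

Lemma detA_ge1 : 1 <= `|\det (int_mx R A)|.
Proof.
rewrite /int_mx det_map_mx -intr_norm -[1]/(1%:~R) ler_int -gtz0_ge1 normr_gt0.
exact: detA_neq0.
Qed.

Lemma frame_coords T' s x d : T' \in unitmx -> T' *m H *m T'^T = int_mx R A ->
  x *m T' = s *: e0 ->
  sigma x d = s * (d *m invmx T'^T) 0 0 /\ qI d = quad H (d *m invmx T'^T).
Proof.
move=> Tu' TA xs; split; last by rewrite quad_mulmx -invmx_frame // TA.
rewrite -{1}(mulmxKV (tr_unit Tu') d) sigma_dual xs sigmaZl.
by rewrite sigmaC sigma_e0.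
Qed.

Lemma D_dual d x : D d -> V1 x -> 0 <= sigma x d.
Proof. by case=> _ /(closure_coneV2_dual T_unit) h _; apply: h. Qed.

Lemma D_pos d x : D d -> V1 x -> 0 < sigma x d.
Proof.
case=> _ /(closure_coneV2 T_unit) hd d0 /(coneV1P T_unit) hx.
rewrite -(mulmxKV (tr_unit T_unit) d) sigma_dual; apply: cone_pair_gt0 => //.
by apply: contra_neq d0 => e; rewrite -(mulmxKV (tr_unit T_unit) d) e mul0mx.
Qed.

Lemma D_qI d : D d -> qI d <= 0.
Proof.
case=> _ /(closure_coneV2 T_unit) [hd _] _.
by rewrite -T_A invmx_frame // -quad_mulmx.
Qed.

Lemma light_vector_in_D (z : 'rV[int]_n.+1) : z != 0 -> qI (int_mx R z) <= 0 ->
  D (int_mx R z) \/ D (- int_mx R z).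
Proof.
move=> z0; rewrite -T_A invmx_frame // -quad_mulmx => q.
have zz : int_mx R z != 0.
  apply: contra_neq z0 => e; apply/rowP => i; apply/eqP.
  by have /rowP/(_ i)/eqP := e; rewrite !mxE intr_eq0.
have [t|t] := lerP 0 ((int_mx R z *m invmx T^T) 0 0); [left|right]; split=> //.
- by exists z.
- exact/(closure_coneV2 T_unit).
- by exists (- z); rewrite /int_mx map_mxN.
- apply/(closure_coneV2 T_unit); split.
    by rewrite quadE !mulNmx sigmaNl sigmaNr opprK -quadE.
  by rewrite mulNmx mxE oppr_ge0 ltW.
- by rewrite oppr_eq0.
Qed.

(** The inverse form takes values in [1 / det A] times the integers. *)
Lemma integral_light_gap (z : 'rV[int]_n.+1) :
  qI (int_mx R z) * `|\det (int_mx R A)| < 1 ->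
  qI (int_mx R z) <= 0.
Proof.
have -> : invmx (int_mx R A) = (\det (int_mx R A))^-1 *: int_mx R (\adj A).
  by rewrite /invmx intA_unit /int_mx map_mx_adj.
have -> : quad ((\det (int_mx R A))^-1 *: int_mx R (\adj A)) (int_mx R z)
    = (\det (int_mx R A))^-1 * ((z *m \adj A *m z^T) 0 0)%:~R.
  rewrite /quad -scalemxAr -scalemxAl mxE; congr (_ * _).
  by rewrite /int_mx map_trmx -!map_mxM mxE.
set m := (z *m _ *m _) 0 0; have := detA_ge1; set a := \det _ => a1.
have a0 : 0 < `|a| by lra.
have [//|p] := lerP (a^-1 * m%:~R) 0.
have -> : a^-1 * m%:~R = `|a|^-1 * `|m|%:~R.
  by rewrite -[LHS]gtr0_norm // normrM normfV intr_norm.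
rewrite mulrC mulrA divff ?gt_eqF // mul1r => m1.
have : (`|m| < 1)%R by rewrite -(ltr_int R).
move=> ml; have m0 : m = 0 by clearbody m; lia.
by move: p; rewrite m0 mulr0 ltxx.
Qed.

(** The cylinder around the axis of [x] is convex, while the part of the double
    light cone below a given height is not: this is why Minkowski's theorem is
    applied to the former, with a radius [de] so small that integrality brings
    the vector back into the light cone. The volume, hence the height [h], is
    the same for all [x] because the frames have the same determinant up to
    sign. *)
Lemma short_lattice_point : exists2 C : R, 0 < C &
  forall x, V1 x -> exists2 d, D d & sigma x d ^+ 2 <= C * - qA x.
Proof.
pose a := `|\det (int_mx R A)|; have a1 : 1 <= a := detA_ge1.
have a0 : 0 < a by lra.
pose de : R := (4 * n.+1%:R * a)^-1.
have nn : (0 : R) < n.+1%:R by [].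
have de0 : 0 < de by rewrite invr_gt0 !mulr_gt0.
pose h := 2 * de^-1 ^+ n.
have h0 : 0 < h by rewrite mulr_gt0 // exprn_gt0 // invr_gt0.
exists (4 * h ^+ 2) => [|x hx]; first by rewrite mulr_gt0 // exprn_gt0.
have [T' [s [s0 s2 Tu' TA xT]]] := coneV1_frame T_unit hx.
rewrite T_A in s2 TA.
pose g : vec := \row_i (if i == ord0 then h^-1 else de^-1).
pose L := invmx T'^T *m diag_mx g.
have dT : 1 <= `|\det T'|.
  by have := a1; rewrite /a -TA det_frame // -{1}(expr1n _ 2) ler_sqr ?nnegrE.
have dg : \det (diag_mx g) = 1 / 2.
  rewrite det_diag big_ord_recl mxE eqxx.
  under eq_bigr do rewrite mxE /=.
  rewrite prodr_const card_ord /h invfM exprVn invrK -mulrA divff ?mulr1 ?mul1r //.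
  by rewrite expf_neq0 // gt_eqF.
have Lu : L \in unitmx.
  rewrite unitmx_mul unitmx_inv tr_unit //= unitmxE dg unitfE; lra.
have dL : `|\det L| < 1.
  rewrite det_mulmx dg det_inv det_tr normrM normfV.
  rewrite [X in _ * X]ger0_norm; last lra.
  rewrite mulrC ltr_pdivrMr ?mul1r; lra.
have [z [z0 zL]] := minkowski_linear_forms Lu dL.
pose c := int_mx R z *m invmx T'^T.
have [sx qc] := frame_coords (int_mx R z) Tu' TA xT.
have cE j : (int_mx R z *m L) 0 j = c 0 j * g 0 j.
  by rewrite /L mulmxA mul_mx_diag mxE.
have c0 : `|c 0 0| <= 2 * h.
  have := zL 0; rewrite cE [g _ _]mxE eqxx normrM normfV (gtr0_norm h0).
  by rewrite ler_pdivrMr.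
have ci (i : 'I_n) : c 0 (lift ord0 i) ^+ 2 <= 4 * de ^+ 2.
  have := zL (lift ord0 i); rewrite cE [g _ _]mxE /= normrM normfV (gtr0_norm de0).
  rewrite ler_pdivrMr // => hc.
  have -> : 4 * de ^+ 2 = (2 * de) ^+ 2 by ring.
  by rewrite -real_normK ?num_real // ler_sqr ?nnegrE // mulr_ge0 // ltW.
have q0 : qI (int_mx R z) <= 0.
  apply: integral_light_gap; rewrite -/a qc -/c.
  have : quad H c <= n%:R * (4 * de ^+ 2).
    rewrite quadHE; apply: le_trans (_ : spdot c c <= _).
      by have := sqr_ge0 (c 0 0); lra.
    have -> : n%:R * (4 * de ^+ 2) = \sum_(i < n) 4 * de ^+ 2.
      by rewrite sumr_const card_ord mulr_natl.
    rewrite ler_sum // => i _.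
    by rewrite -expr2.
  move=> hq; apply: le_lt_trans (ler_wpM2r (ltW a0) hq) _.
  have n1 : n.+1%:R = n%:R + 1 :> R by rewrite -natr1.
  have -> : n%:R * (4 * de ^+ 2) * a = n%:R / n.+1%:R * (4 * n.+1%:R * a)^-1.
    by rewrite /de; field; rewrite !gt_eqF.
  have k1 : n%:R / n.+1%:R <= 1 :> R by rewrite ler_pdivrMr // mul1r n1; lra.
  have k2 : (4 * n.+1%:R * a)^-1 < 1.
    rewrite invf_lt1 ?mulr_gt0 //.
    have nn1 : (1 : R) <= n.+1%:R by rewrite ler1n.
    have : 1 <= n.+1%:R * a by rewrite mulr_ege1.
    by rewrite -mulrA; lra.
  have k3 : 0 <= n%:R / n.+1%:R :> R by rewrite divr_ge0.
  apply: le_lt_trans (_ : (4 * n.+1%:R * a)^-1 < _) => //.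
  by rewrite ler_piMl // ltW // -/de.
have bnd : sigma x (int_mx R z) ^+ 2 <= 4 * h ^+ 2 * - qA x.
  rewrite sx -/c -s2 exprMn mulrC ler_wpM2r ?sqr_ge0 //.
  have -> : 4 * h ^+ 2 = (2 * h) ^+ 2 by ring.
  by rewrite -real_normK ?num_real // ler_sqr ?nnegrE // mulr_ge0 // ltW.
have [dz|dz] := light_vector_in_D z0 q0;
  [exists (int_mx R z) => //|exists (- int_mx R z) => //].
by rewrite sigmaNr sqrrN.
Qed.
End Lattice.
(** * Perfect points as vertices of the feasible polyhedron *)

Lemma finite_int_mx m k (K : nat) :
  finite_set [set z : 'M[int]_(m, k) | forall i j, (absz (z i j) <= K)%N].
Proof.
pose f (M : 'M['I_(K + K).+1]_(m, k)) : 'M[int]_(m, k) :=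
  map_mx (fun i : 'I__ => i%:Z - K%:Z) M.
apply: (@sub_finite_set _ _ (f @` setT)); last exact/finite_image/finite_finset.
move=> z hz; exists (map_mx (fun a : int => inord (absz (a + K%:Z))) z) => //.
apply/matrixP => i j; rewrite !mxE inordK; have := hz i j.
  by move: (z i j) => a; lia.
by move: (z i j) => a; lia.
Qed.

Lemma finite_gap (R : realType) (U : eqType) (F : set U) (f : U -> R) :
  finite_set F -> (forall u, F u -> 0 < f u) ->
  exists2 t, 0 < t & forall u, F u -> t <= f u.
Proof.
move=> /finite_seqP [s ->]; elim: s => [|u s IH] h; first by exists 1.
have [v vs|t t0 ht] := IH; first by apply: h; rewrite /= inE [_ \in s]vs orbT.
have u0 : 0 < f u by apply: h; rewrite /= mem_head.
exists (Num.min t (f u)) => [|v]; first by rewrite lt_min t0.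
rewrite /= inE => /orP[/eqP ->|vs]; first by rewrite ge_min lexx orbT.
by rewrite ge_min ht.
Qed.

Section Spanning.
Variables (R : realType) (n : nat).
Local Notation vec := 'rV[R]_n.+1.
Implicit Types (M : set vec) (r : vec).

Lemma sigma_eq0 r : sigma r r = 0 -> r = 0.
Proof.
rewrite sigmaE => /eqP; rewrite psumr_eq0 => [/allP h|i _]; last first.
  by rewrite -expr2 sqr_ge0.
apply/rowP => i; have := h i; rewrite mem_index_enum mulf_eq0 orbb mxE.
by move=> /(_ isT)/eqP.
Qed.

Lemma spans_basis M : spans M ->
  exists2 B : 'M[R]_n.+1, (forall i, M (row i B)) & B \in unitmx.
Proof.
move=> sM.
have h (s : seq vec) : exists k (B : 'M[R]_(k, n.+1)),
    (forall i, M (row i B)) /\ forall v, v \in s -> (v <= B)%MS.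
  elim: s => [|v s [k [B [BM hB]]]].
    by exists 0%N, 0; split=> // -[].
  have [k' [B' [BM' hB']]] := sM v.
  exists (k' + k)%N, (col_mx B' B); split=> [i|w].
    by case: (split_ordP i) => j ->; rewrite ?rowKu ?rowKd.
  rewrite inE => /orP[/eqP ->|/hB ws].
    by apply: submx_trans hB' _; rewrite -addsmxE addsmxSl.
  by apply: submx_trans ws _; rewrite -addsmxE addsmxSr.
have [k [B [BM hB]]] := h [seq delta_mx 0 i | i : 'I_n.+1].
have fB : row_full B.
  rewrite -sub1mx; apply/row_subP => i; rewrite row1; apply: hB.
  by apply: map_f; rewrite mem_enum.
exists (rowsub (fullrankfun fB) B); last exact: fullrowsub_unit.
by move=> i; rewrite row_rowsub.
Qed.

Lemma mulmx_tr_row k (B : 'M[R]_(k, n.+1)) r i :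
  (r *m B^T) 0 i = sigma r (row i B).
Proof. by rewrite sigmaE mxE; apply: eq_bigr => j _; rewrite !mxE. Qed.

Lemma spans_ortho M r : spans M -> (forall d, M d -> sigma r d = 0) -> r = 0.
Proof.
move=> /spans_basis [B BM Bu] h; rewrite -(mulmxK (_ : B^T \in unitmx) r).
  have -> : r *m B^T = 0 by apply/rowP => i; rewrite mulmx_tr_row h // mxE.
  by rewrite mul0mx.
by rewrite unitmx_tr.
Qed.

Lemma ortho_spans M : finite_set M ->
  (forall r, (forall d, M d -> sigma r d = 0) -> r = 0) -> spans M.
Proof.
move=> /finite_seqP [s Ms] h.
pose B : 'M[R]_(size s, n.+1) := \matrix_(i < size s) nth 0 s i.
have BM i : M (row i B) by rewrite Ms /= rowK mem_nth.
suff fB : row_full B by move=> v; exists (size s), B; split=> //;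
  apply: submx_full.
suff : row_free B^T by rewrite /row_free /row_full mxrank_tr.
rewrite -kermx_eq0; apply/negPn/negP => /rowV0Pn [r /sub_kermxP rB] /negP;
  apply.
apply/eqP/h => d; rewrite Ms => ds.
have hi : (index d s < size s)%N by rewrite index_mem.
have := mulmx_tr_row B r (Ordinal hi).
by rewrite rB mxE rowK /= nth_index // => <-.
Qed.

Lemma spans_nonempty M : spans M -> exists d, M d.
Proof. by case/spans_basis => B BM _; exists (row 0 B). Qed.
End Spanning.

Section Minima.
Variables (R : realType) (n : nat).
Local Notation vec := 'rV[R]_n.+1.
Variables (V1 D : set vec).

Definition feasible : set vec :=
  [set x | V1 x /\ forall d, D d -> 1 <= sigma x d].
Definition facet (x : vec) : set vec := [set d | D d /\ sigma x d = 1].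

(** The graph of all directions, blind ones included: it contains the Voronoi
    graph, and its equivariance does not involve the closure of the cone. *)
Definition adjacent x : set vec :=
  [set y | exists r rho, [/\ direction D x r, 0 < rho, y = x + rho *: r
                          & perfect_points V1 D y]].

Lemma neighbours_adjacent x : neighbours V1 D x `<=` adjacent x.
Proof. by move=> y [r [rho [h1 _ h2 h3 h4]]]; exists r, rho. Qed.

Lemma perfect_min_vectors x : perfect_points V1 D x ->
  min_vectors D x = facet x.
Proof. by case=> _ mu1; rewrite /min_vectors mu1. Qed.

(** Scaling the minimum to 1 makes the perfect points vertices of the
    polyhedron of feasible points. *)
Lemma perfect_pointsP x :
  perfect_points V1 D x <-> feasible x /\ spans (facet x).
Proof.
split=> [hx|[[hx h] sx]].
  have Mx := perfect_min_vectors hx; case: hx => -[hx]; rewrite Mx => sx mu1.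
  split=> //; split=> // d hd; move: mu1; rewrite /mu /minimum.
  case: xgetP => [_ -> [_ hl]|_ /eqP]; last by rewrite eq_sym oner_eq0.
  by move=> e; rewrite -e; apply: hl; exists d.
have mu1 : mu D x = 1.
  apply: xget_unique.
    split=> [|_ [d hd <-]]; last exact: h.
    by have [d [hd d1]] := spans_nonempty sx; exists d.
  move=> y [[d hd <-] hl]; apply/eqP; rewrite eq_le h // andbT.
  by have [d' [hd' <-]] := spans_nonempty sx; apply: hl; exists d'.
by split=> //; split=> //; rewrite /min_vectors mu1.
Qed.
End Minima.
Section Perfect.
Variables (R : realType) (n : nat).
Local Notation vec := 'rV[R]_n.+1.
Local Notation H := (Hmx R n).
Local Notation e0 := (delta_mx 0 0 : vec).
Implicit Types (x y d r : vec).

Variables (A : 'M[int]_n.+1) (T : 'M[R]_n.+1).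
Hypothesis T_unit : T \in unitmx.
Hypothesis T_A : T *m H *m T^T = int_mx R A.
Local Notation V1 := (coneV1 T).
Local Notation D := (lattice_points (coneV2 T)).
Local Notation qA := (quad (int_mx R A)).

Lemma light_coord_le c j : quad H c <= 0 -> `|c 0 j| <= `|c 0 0|.
Proof.
rewrite quadHE => q; case: (unliftP ord0 j) => [i|] -> //.
rewrite -ler_sqr ?nnegrE // !real_normK ?num_real //.
have : c 0 (lift ord0 i) ^+ 2 <= spdot c c.
  rewrite /spdot (bigD1 i) //= -expr2 lerDl sumr_ge0 // => k _.
  by rewrite -expr2 sqr_ge0.
lra.
Qed.

Lemma sum_norm_ge0 (B : 'M[R]_n.+1) : 0 <= \sum_i \sum_l `|B i l|.
Proof. by rewrite sumr_ge0 // => i _; rewrite sumr_ge0. Qed.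

Lemma light_mulmx_le (B : 'M[R]_n.+1) c j : quad H c <= 0 ->
  `|(c *m B) 0 j| <= n.+1%:R * `|c 0 0| * \sum_i \sum_l `|B i l|.
Proof.
move=> q; apply: le_trans (ler_norm_mulmx_coord _ _ _) _.
rewrite ler_wpM2r ?sum_norm_ge0 //.
have -> : n.+1%:R * `|c 0 0| = \sum_(i < n.+1) `|c 0 0|.
  by rewrite sumr_const card_ord mulr_natl.
by apply: ler_sum => i _; apply: light_coord_le.
Qed.

(** In the frame of [x] a vector of the light cone is bounded by its height,
    which is proportional to [sigma x d]. *)
Lemma finite_D_le x a : V1 x -> finite_set [set d | D d /\ sigma x d <= a].
Proof.
move=> hx; have [T' [s [s0 _ Tu' TA xT]]] := coneV1_frame T_unit hx.
rewrite T_A in TA.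
pose K := Num.bound (n.+1%:R * (`|a| / s) * \sum_i \sum_l `|T'^T i l|).
apply: (@sub_finite_set _ _
  ((fun z : 'rV[int]_n.+1 => int_mx R z) @`
    [set z : 'rV[int]_n.+1 | forall i j, (absz (z i j) <= K)%N])).
  move=> d [hd da]; case: (hd) => -[z dz] _ _; exists z => // i j.
  rewrite (ord1 i) -(ler_nat R) natr_absz intr_norm.
  have -> : (z 0 j)%:~R = d 0 j by rewrite dz mxE.
  pose c := d *m invmx T'^T.
  have [sx qc] := frame_coords d Tu' TA xT.
  have qc0 : quad H c <= 0 by rewrite -qc; apply: (D_qI T_unit T_A).
  have ca : `|c 0 0| <= `|a| / s.
    rewrite ler_pdivlMr // mulrC -{1}(gtr0_norm s0) -normrM -sx.
    have sp := D_pos T_unit hd hx; rewrite !ger0_norm ?(ltW sp) //.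
    exact: le_trans (ltW sp) da.
  rewrite -[d](mulmxKV (tr_unit Tu')) -/c.
  apply: le_trans (light_mulmx_le _ _ qc0) _;
    apply: le_trans (ltW (archi_boundP _)).
    by rewrite ler_wpM2r ?sum_norm_ge0 ?ler_wpM2l.
  by rewrite mulr_ge0 ?sum_norm_ge0 // mulr_ge0 // divr_ge0 // ltW.
exact/finite_image/finite_int_mx.
Qed.

Lemma finite_facet x : V1 x -> finite_set (facet D x).
Proof.
move=> hx; apply: sub_finite_set (finite_D_le 1 hx).
by move=> d [hd d1]; split=> //=; rewrite d1.
Qed.

(** The values of [x] on the points of [D] outside its facet are bounded away
    from 1, and a small multiple of [r] changes them at most proportionally,
    since [x + h *: r] and [x - h *: r] are nonnegative on [D]. *)
Lemma feasible_line x r : feasible V1 D x ->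
  (forall d, facet D x d -> sigma r d = 0) ->
  exists2 e, 0 < e & feasible V1 D (x + e *: r) /\ feasible V1 D (x - e *: r).
Proof.
move=> [hx h1] hr; have [h h0 [hp hm]] := coneV1_open T_unit r hx.
have fin : finite_set [set d | D d /\ 1 < sigma x d <= 2].
  by apply: sub_finite_set (finite_D_le 2 hx) => d [hd /andP[]].
have [|t t0 ht] := @finite_gap _ _ _ (fun d => sigma x d - 1) fin.
  by move=> d [_ /andP[? _]]; rewrite subr_gt0.
pose g := Num.min t 1; have g0 : 0 < g by rewrite lt_min t0 ltr01.
have gap d : D d -> sigma x d = 1 \/ 1 + g <= sigma x d.
  move=> hd; have := h1 d hd; rewrite le_eqVlt => /orP[/eqP <-|lt];
    first by left.
  right; have [le2|lt2] := lerP (sigma x d) 2.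
    have : g <= sigma x d - 1.
      by apply: le_trans (ht d _); [rewrite ge_min lexx|split=> //; rewrite lt].
    lra.
  have g1 : g <= 1 by rewrite ge_min lexx orbT.
  by clearbody g; lra.
(* Mixing [x], which is at least [1 + g] there, with a point that is at least 0
   in the proportion [l] leaves at least [(1 - l) * (1 + g)], that is 1. *)
pose l := g / (1 + g); have l0 : 0 < l by rewrite divr_gt0 //; lra.
have l1 : l < 1 by rewrite ltr_pdivrMr; lra.
have lg : (1 - l) * (1 + g) = 1 by rewrite /l; field; lra.
have key r' : V1 (x + h *: r') -> (forall d, facet D x d -> sigma r' d = 0) ->
    feasible V1 D (x + (l * h) *: r').
  move=> hp' hr'; split.
    have -> : x + (l * h) *: r' = (1 - l) *: x + l *: (x + h *: r').
      by rewrite scalerDr scalerA addrA -scalerDl subrK scale1r.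
    by apply: coneV1D => //; apply: coneV1Z => //; rewrite subr_gt0.
  move=> d hd; have [e|ge] := gap d hd.
    by rewrite sigmaDl sigmaZl hr' // e mulr0 addr0.
  have p := D_dual T_unit hd hp'; rewrite sigmaDl sigmaZl in p.
  rewrite sigmaDl sigmaZl -mulrA.
  have := mulr_ge0 (ltW l0) p.
  have : (1 - l) * (1 + g) <= (1 - l) * sigma x d by rewrite ler_wpM2l //; lra.
  lra.
exists (l * h); first exact: mulr_gt0.
split; first exact: key.
rewrite -scalerN; apply: key => [|d hd]; first by rewrite scalerN.
by rewrite sigmaNl hr // oppr0.
Qed.

Lemma exists_feasible : exists x, feasible V1 D x.
Proof.
have [C C0 hC] := short_lattice_point T_unit T_A.
pose x0 : vec := e0 *m invmx T.
have hx0 : V1 x0 by exists e0 => //; apply: coneC_e0.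
have [|t t0 ht] := @finite_gap _ _ _ (sigma x0) (finite_D_le 1 hx0).
  by move=> d [hd _]; apply: (D_pos T_unit hd hx0).
pose m := Num.min t 1; have m0 : 0 < m by rewrite lt_min t0 ltr01.
exists (m^-1 *: x0); split; first by apply: coneV1Z; rewrite ?invr_gt0.
move=> d hd; rewrite sigmaZl mulrC ler_pdivlMr // mul1r.
have [le1|lt1] := lerP (sigma x0 d) 1.
  by apply: le_trans (ht d _); [rewrite ge_min lexx|split].
by apply: le_trans (ltW lt1); rewrite ge_min lexx orbT.
Qed.

Lemma feasible_quad C x : (forall x, V1 x ->
  exists2 d, D d & sigma x d ^+ 2 <= C * - qA x) ->
  feasible V1 D x -> 1 <= C * - qA x.
Proof.
move=> hC [hx h1]; have [d hd le] := hC _ hx; apply: le_trans le.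
by rewrite expr_ge1 ?h1 // (le_trans ler01 (h1 _ hd)).
Qed.

Local Notation time x := (sigma x (e0 *m T^T)).

Lemma timeE x : time x = (x *m T) 0 0.
Proof. by rewrite -sigma_mulmx sigma_e0. Qed.

(** Feasible points satisfy the closed condition [- qA x >= C^-1], so that the
    polyhedron is closed although the cone is open. *)
Lemma feasible_compact a : compact (feasible V1 D `&` [set x | time x <= a]).
Proof.
have [C C0 hC] := short_lattice_point T_unit T_A.
have E : feasible V1 D = [set x | qA x <= - C^-1] `&` [set x | 0 <= time x]
    `&` \bigcap_(d in D) [set x | 1 <= sigma x d].
  apply/seteqP; split=> x.
    move=> hf; split; last by move=> d hd; apply: hf.2.
    split=> /=; last by rewrite timeE;
      case: ((coneV1P T_unit _).1 hf.1) => _ /ltW.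
    have := feasible_quad hC hf; rewrite -ler_pdivrMl // mulr1; lra.
  move=> [[q t] h1]; split=> [|d hd]; last exact: h1.
  have q0 : quad H (x *m T) < 0.
    have Ci : 0 < C^-1 by rewrite invr_gt0.
    by rewrite -quadA T_A; move: q => /=; lra.
  apply/(coneV1P T_unit); split=> //; rewrite lt_neqAle -timeE t andbT eq_sym.
  rewrite timeE; apply: contraTneq q0 => e.
  by rewrite quadHE e expr0n /= oppr0 add0r -leNgt spdot_ge0.
have cl : closed (feasible V1 D `&` [set x | time x <= a]).
  apply: closedI; last exact: closed_sigma_le.
  rewrite E; apply: closedI; last by apply: closed_bigI => d _;
    exact: closed_sigma_ge.
  by apply: closedI; [exact: closed_quad_le|exact: closed_sigma_ge].
pose K := n.+1%:R * `|a| * \sum_i \sum_l `|(invmx T) i l|.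
apply: (subclosed_compact cl
  (@rV_compact _ _ (fun=> `[(- K), K]%classic) (fun=> @segment_compact _ _ _))).
move=> x [[hx _] /= ta] i; rewrite in_itv /= -ler_norml.
rewrite -[x](mulmxK T_unit).
have [q t0] := (coneV1P T_unit _).1 hx.
apply: le_trans (light_mulmx_le _ _ (ltW q)) _.
rewrite ler_wpM2r ?sum_norm_ge0 ?ler_wpM2l //.
by rewrite timeE in ta; rewrite !ger0_norm ?(ltW t0) // (le_trans (ltW t0)).
Qed.

(** Strict convexity of the norm makes a farthest point of the lowest face an
    extreme point; and an extreme point is perfect by [feasible_line]. *)
Lemma exists_perfect : exists x, perfect_points V1 D x.
Proof.
have [x1 f1] := exists_feasible.
have [x2 /set_mem [f2 _] min2] :=
  compact_EVT_min (ex_intro _ x1 (conj f1 (lexx (time x1))))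
    (@feasible_compact _)
    (continuous_subspaceT (@sigma_continuous _ _ (e0 *m T^T))).
have min y : feasible V1 D y -> time x2 <= time y.
  move=> fy; have [le|/ltW lt] := lerP (time y) (time x1).
    by apply: min2; apply/mem_set.
  by apply: le_trans lt; apply: min2; apply/mem_set; split=> //=.
have [x3 /set_mem [f3 t3] max3] :=
  compact_EVT_max (ex_intro _ x2 (conj f2 (lexx (time x2))))
  (@feasible_compact _) (continuous_subspaceT (@quad_continuous _ _ 1%:M)).
exists x3; apply/perfect_pointsP; split=> //; apply: ortho_spans.
  exact: (finite_facet f3.1).
move=> r hr; have [e e0 [fp fm]] := feasible_line f3 hr.
have tr : time r = 0.
  have := min _ fp; have := min _ fm; rewrite sigmaBl sigmaDl !sigmaZl.
  move: t3 => /= t3 h1 h2.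
  have /eqP : e * time r = 0 by lra.
  by rewrite mulf_eq0 (gt_eqF e0) => /eqP.
have q1 y : quad 1%:M y = sigma y y by rewrite quadE mulmx1.
have h1 : quad 1%:M (x3 + e *: r) <= quad 1%:M x3.
  apply: max3; apply/mem_set; split=> //=.
  by rewrite sigmaDl sigmaZl tr mulr0 addr0.
have h2 : quad 1%:M (x3 - e *: r) <= quad 1%:M x3.
  apply: max3; apply/mem_set; split=> //=.
  by rewrite sigmaBl sigmaZl tr mulr0 subr0.
move: h1 h2; rewrite !q1 sigmaBl !sigmaDl !sigmaDr !sigmaNr !sigmaZl !sigmaZr.
move=> h1 h2; have rr : 0 <= sigma r r.
  by rewrite sigmaE sumr_ge0 // => i _; rewrite -expr2 sqr_ge0.
apply: sigma_eq0; apply/eqP; rewrite eq_le rr andbT.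
have ee : 0 < e * e by rewrite mulr_gt0.
by rewrite -(pmulr_rle0 _ ee); lra.
Qed.
End Perfect.
(** * Actions of integral matrices *)

Lemma finite_representatives (U : choiceType) (W : Type) (P : set U)
    (f : U -> W) :
  finite_set (f @` P) ->
  exists F, [/\ finite_set F, F `<=` P & forall x, P x ->
    exists2 y, F y & f y = f x].
Proof.
move=> fin; have [[x0 Px0]|P0] := pselect (exists x, P x); last first.
  by exists set0; split=> // x Px; case: P0; exists x.
pose h w := xget x0 [set x | P x /\ f x = w].
have hP x : P x -> P (h (f x)) /\ f (h (f x)) = f x.
  by move=> Px; apply: (@xgetPex _ x0 [set y | P y /\ f y = f x]); exists x.
exists (h @` (f @` P)); split; first exact: finite_image.
  by move=> _ [_ [x Px <-] <-]; case: (hP x Px).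
move=> x Px; exists (h (f x)); last by case: (hP x Px).
by exists (f x) => //; exists x.
Qed.

Section Actions.
Variables (R : realType) (n : nat).
Local Notation vec := 'rV[R]_n.+1.
Implicit Types (x y d : vec) (g h : 'M[int]_n.+1) (G : set 'M[int]_n.+1).

Lemma int_mxM m k l (B : 'M[int]_(m, k)) (C : 'M[int]_(k, l)) :
  int_mx R (B *m C) = int_mx R B *m int_mx R C.
Proof. exact: map_mxM. Qed.

Lemma int_mx1 m : int_mx R (1%:M : 'M[int]_m) = 1%:M.
Proof. exact: map_mx1. Qed.

Lemma int_mxT m k (B : 'M[int]_(m, k)) : int_mx R B^T = (int_mx R B)^T.
Proof. by rewrite /int_mx map_trmx. Qed.

Lemma int_mx_unit g : g \in unitmx -> int_mx R g \in unitmx.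
Proof.
move=> gu; have : int_mx R g *m int_mx R (invmx g) = 1%:M.
  by rewrite -int_mxM mulmxV // int_mx1.
by case/mulmx1_unit.
Qed.

Lemma act1 x : act x 1%:M = x.
Proof. by rewrite /act int_mx1 mulmx1. Qed.

Lemma actM x g h : act x (g *m h) = act (act x g) h.
Proof. by rewrite /act int_mxM mulmxA. Qed.

Lemma actK g : g \in unitmx ->
  cancel (fun x => act x g) (fun x => act x (invmx g)).
Proof. by move=> gu x; rewrite -actM mulmxV // act1. Qed.

Lemma actVK g : g \in unitmx ->
  cancel (fun x => act x (invmx g)) (fun x => act x g).
Proof. by move=> gu x; rewrite -actM mulVmx // act1. Qed.

Lemma sigma_act x d g : sigma (act x g) d = sigma x (act d g^T).
Proof. by rewrite /act sigma_mulmx int_mxT. Qed.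

Lemma orbit_act G x g : is_subgroup G -> G g ->
  orbit_of G (act x g) = orbit_of G x.
Proof.
case=> uG _ mG vG Gg; apply/seteqP; split=> [_ [h Gh <-]|_ [h Gh <-]].
  by exists (g *m h); [exact: mG|rewrite actM].
exists (invmx g *m h); first by apply: mG => //; apply: vG.
by rewrite -actM mulmxA mulmxV ?mul1mx //; apply: uG.
Qed.

Lemma set_orbit_act G (e : set vec) g : is_subgroup G -> G g ->
  [set [set act x h | x in [set act x g | x in e]] | h in G]
    = [set [set act x h | x in e] | h in G].
Proof.
case=> uG _ mG vG Gg.
have im h : [set act x h | x in [set act x g | x in e]] 
      = [set act x (g *m h) | x in e].
  apply/seteqP; split=> [_ [_ [x ex <-] <-]|_ [x ex <-]].
    by exists x => //; rewrite actM.
  by exists (act x g); [exists x|rewrite actM].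
apply/seteqP; split=> [_ [h Gh <-]|_ [h Gh <-]].
  by exists (g *m h); [exact: mG|rewrite im].
exists (invmx g *m h); first by apply: mG => //; apply: vG.
by rewrite im mulmxA mulmxV ?mul1mx //; apply: uG.
Qed.

Lemma stab_subgroup G x : is_subgroup G -> is_subgroup (stab G x).
Proof.
case=> uG oG mG vG; split.
- by move=> g [/uG].
- by split=> //; rewrite act1.
- by move=> g h [Gg xg] [Gh xh]; split; [exact: mG|rewrite actM xg].
- move=> g [Gg xg]; split; first exact: vG.
  by rewrite -{1}xg actK //; apply: uG.
Qed.

Lemma mulmx_int_inj (B X Y : 'M[int]_n.+1) : \det B != 0 ->
  B *m X = B *m Y -> X = Y.
Proof.
move=> B0 /(congr1 (mulmx (\adj B))); rewrite !mulmxA mul_adj_mx !mul_scalar_mx.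
move=> /matrixP e; apply/matrixP => i j; have := e i j; rewrite !mxE.
exact: mulfI.
Qed.

(** The Gram matrix [G] of [B] makes [S *m B^T *m \adj G] an integral right
    inverse of [B] up to the factor [\det G]; hence [invmx B *m (B' - B)] is
    integral as soon as [\det G] divides [B' - B]. *)
Lemma congruent_bases (S B B' : 'M[int]_n.+1) (a := \det (B *m S *m B^T)) :
  \det B != 0 -> B' *m S *m B'^T = B *m S *m B^T -> a != 0 ->
  (forall i j, modz (B i j) a = modz (B' i j) a) ->
  exists2 g, g \in unitmx & B' = B *m g /\ g *m S *m g^T = S.
Proof.
move=> B0 GG a0 cong.
have step (C C' : 'M[int]_n.+1) : \det (C *m S *m C^T) = a ->
    (forall i j, modz (C i j) a = modz (C' i j) a) -> exists g, C' = C *m g.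
  move=> Ca cc; have hq i j : exists q, C' i j - C i j = q * a.
    by apply: modz_eq_subr.
  pose Q := \matrix_(i, j) projT1 (cid (hq i j)) : 'M[int]_n.+1.
  have QE : C' - C = a *: Q.
    apply/matrixP => i j; rewrite mxE [(- C) _ _]mxE [RHS]mxE [Q _ _]mxE.
    by case: cid => q /= ->; rewrite mulrC.
  exists (1%:M + S *m C^T *m \adj (C *m S *m C^T) *m Q).
  rewrite mulmxDr mulmx1 !mulmxA mul_mx_adj Ca mul_scalar_mx -QE.
  by rewrite addrC subrK.
have [g Bg] := step B B' erefl cong.
have [g' Bg'] := step B' B (congr1 determinant GG) (fun i j => esym (cong i j)).
have gg : g *m g' = 1%:M.
  by apply: (mulmx_int_inj B0); rewrite mulmxA -Bg -Bg' mulmx1.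
have [gu _] := mulmx1_unit gg.
exists g => //; split=> //; apply: (mulmx_int_inj B0); apply: trmx_inj.
rewrite !trmx_mul; apply: (mulmx_int_inj B0); apply: trmx_inj.
by move: GG; rewrite Bg !trmx_mul !trmxK !mulmxA => ->.
Qed.
End Actions.
(** * Finiteness modulo the group *)

Section Finiteness.
Variables (R : realType) (n : nat).
Local Notation vec := 'rV[R]_n.+1.
Local Notation H := (Hmx R n).
Implicit Types (x y d r v : vec) (g h : 'M[int]_n.+1).

Variables (A : 'M[int]_n.+1) (T : 'M[R]_n.+1).
Hypothesis T_unit : T \in unitmx.
Hypothesis T_A : T *m H *m T^T = int_mx R A.
Local Notation V1 := (coneV1 T).
Local Notation D := (lattice_points (coneV2 T)).
Local Notation Omega := (reduced_aut A V1).
Local Notation P := (perfect_points V1 D).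
Local Notation adjacent := (adjacent V1 D).
Local Notation AR := (int_mx R A).

Lemma isometry_bilinear x y g : AutZ A g ->
  sigma (act x g *m AR) (act y g) = sigma (x *m AR) y.
Proof.
case=> _ gA.
by rewrite -[in RHS]gA !int_mxM int_mxT /act !mulmxA [in RHS]sigma_mulmx trmxK.
Qed.

Lemma AutZ_inv g : AutZ A g -> AutZ A (invmx g).
Proof.
case=> gu gA; split; first by rewrite unitmx_inv.
rewrite -{1}gA !mulmxA mulVmx // mul1mx -mulmxA -trmx_mul mulVmx //.
by rewrite trmx1 mulmx1.
Qed.

(** The cone is one half of the timelike vectors, and the sign of the product
    with a single point of the cone tells the halves apart. *)
Lemma reduced_autP g x : AutZ A g -> V1 x -> V1 (act x g) -> Omega g.
Proof.
move=> gA hx hxg; split=> //.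
have neg := coneV1_of_neg T_unit; have qn := coneV1_quad T_unit.
have sn := coneV1_neg T_unit; rewrite T_A in neg qn sn.
apply/seteqP; split=> [_ [y hy <-]|y hy].
  by apply: (neg _ _ hxg); rewrite ?quadE isometry_bilinear // ?sn // -quadE qn.
exists (act y (invmx g)); last by rewrite actVK //; case: gA.
apply: (neg _ _ hx).
  by rewrite quadE isometry_bilinear ?qn //; apply: AutZ_inv.
by rewrite -(isometry_bilinear _ _ gA) actVK ?sn //; case: gA.
Qed.

Lemma Omega_V1 g x : Omega g -> V1 x -> V1 (act x g).
Proof. by move=> [_ E] hx; rewrite -E; exists x. Qed.

Lemma Omega_unit g : Omega g -> g \in unitmx.
Proof. by case=> -[]. Qed.

Lemma Omega_inv g : Omega g -> Omega (invmx g).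
Proof.
move=> gO; have := exists_feasible T_unit T_A => -[x [hx _]].
apply: (@reduced_autP _ (act x g)); first by apply: AutZ_inv; case: gO.
  exact: Omega_V1.
by rewrite actK //; exact: Omega_unit.
Qed.

Lemma Omega_subgroup : is_subgroup Omega.
Proof.
have [x [hx _]] := exists_feasible T_unit T_A.
split=> [g /Omega_unit //||g h gO hO|g]; last exact: Omega_inv.
- apply: (@reduced_autP _ x); rewrite ?act1 //.
  by split; rewrite ?unitmx1 // mul1mx trmx1 mulmx1.
- apply: (@reduced_autP _ x) => //; last by rewrite actM;
  do 2 apply: Omega_V1 => //.
  split; first by rewrite unitmx_mul !Omega_unit.
  have [[_ gA] _] := gO; have [[_ hA] _] := hO.
  by rewrite trmx_mul mulmxA -(mulmxA g) -(mulmxA g) hA.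
Qed.

Lemma Omega_D g d : Omega g -> D d -> D (act d g^T).
Proof.
move=> gO hd; have [[z dz] /(closure_coneV2_dual T_unit) dd d0] := hd; split.
- by exists (z *m g^T); rewrite int_mxM dz.
- apply/(closure_coneV2_dual T_unit) => x hx.
  by rewrite -sigma_act; apply/dd/Omega_V1.
- have gu : g^T \in unitmx by rewrite unitmx_tr Omega_unit.
  by apply: contra_neq d0 => e; rewrite -(actK gu d) e /act mul0mx.
Qed.

Lemma Omega_feasible g x : Omega g -> feasible V1 D x ->
  feasible V1 D (act x g).
Proof.
move=> gO [hx h1]; split; first exact: Omega_V1.
by move=> d hd; rewrite sigma_act; apply/h1/Omega_D.
Qed.

Lemma facet_act g x d : Omega g -> facet D (act x g) d -> facet D x (act d g^T).
Proof. by move=> gO [hd d1]; split; rewrite -?sigma_act //; apply: Omega_D. Qed.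

Lemma facet_actV g x d : Omega g -> facet D x d ->
  facet D (act x g) (act d (invmx g)^T).
Proof.
move=> gO hd; apply: facet_act; first exact: Omega_inv.
by rewrite actK //; exact: Omega_unit.
Qed.

Lemma Omega_perfect g x : Omega g -> P x -> P (act x g).
Proof.
move=> gO /perfect_pointsP [fx sx]; apply/perfect_pointsP.
split; first exact: Omega_feasible.
move=> v; have [k [B [BM vB]]] := sx (act v g^T).
exists k, (B *m int_mx R (invmx g)^T); split=> [i|].
  by rewrite row_mul; apply: facet_actV.
have -> : v = act (act v g^T) (invmx g)^T.
  by rewrite -actM -trmx_mul mulVmx ?trmx1 ?act1 // Omega_unit.
exact: submxMr.
Qed.

Lemma adjacent_act g x y : Omega g -> P x -> adjacent x y ->
  adjacent (act x g) (act y g).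
Proof.
move=> gO Px [r [rho [[r0 rM [B [Bf BM]]] rho0 -> Py]]].
have gu := Omega_unit gO.
exists (act r g), rho; split=> //; last by apply: Omega_perfect.
  rewrite (perfect_min_vectors Px) in rM BM; split.
  - by apply: contra_neq r0 => e; rewrite -(actK gu r) e /act mul0mx.
  - move=> d; rewrite (perfect_min_vectors (Omega_perfect gO Px)) => hd.
    by rewrite sigma_act; apply/rM/facet_act.
  - exists (B *m int_mx R (invmx g)^T); split=> [|i].
      rewrite /row_free mxrankMfree // row_free_unit int_mx_unit //.
      by rewrite unitmx_tr unitmx_inv.
    have [h1 h2] := BM i.
    rewrite (perfect_min_vectors (Omega_perfect gO Px)) row_mul.
    split; first exact: facet_actV.
    by rewrite sigma_act -actM -trmx_mul mulmxV // trmx1 act1.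
by rewrite /act mulmxDl scalemxAl.
Qed.

(** The facet of an interior point of a feasible segment is contained in the
    facets of both ends, so it is orthogonal to the segment. *)
Lemma no_perfect_between x v t : feasible V1 D x -> feasible V1 D (x + v) ->
  0 < t < 1 -> P (x + t *: v) -> v = 0.
Proof.
move=> [_ hx] [_ hv] /andP[t0 t1] /perfect_pointsP [_ sp].
apply: (spans_ortho sp) => d [hd]; rewrite sigmaDl sigmaZl => e.
have := hx d hd; have := hv d hd; rewrite sigmaDl => h1 h2.
have h3 : 0 <= (1 - t) * (sigma x d - 1) by rewrite mulr_ge0; lra.
have h4 : 0 <= t * (sigma x d + sigma v d - 1) by rewrite mulr_ge0; lra.
have h5 : (1 - t) * (sigma x d - 1) = 0 by lra.
have h6 : sigma x d = 1.
  by move/eqP: h5; rewrite mulf_eq0 => /orP[]/eqP; lra.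
have /eqP : t * sigma v d = 0 by lra.
by rewrite mulf_eq0 (gt_eqF t0) => /eqP.
Qed.

(** The direction is orthogonal to a hyperplane spanned by the shared facet,
    which fixes it up to a factor; the factor is positive because directions
    are nonnegative on the facet of [x]; and a ray issued from [x] meets at
    most one other perfect point. *)
Lemma adjacent_inj x y y' : P x -> adjacent x y -> adjacent x y' ->
  (forall d, facet D x d -> facet D y d -> facet D y' d) -> y = y'.
Proof.
move=> Px [r [rho [[r0 rM [B [Bf BM]]] rho0 yE Py]]].
move=> [r' [rho' [[r0' rM' _] rho0' yE' Py']]] hyy.
rewrite (perfect_min_vectors Px) in rM BM rM'.
have [fx sx] := (perfect_pointsP _ _ _).1 Px.
have [fy _] := (perfect_pointsP _ _ _).1 Py.
have [fy' _] := (perfect_pointsP _ _ _).1 Py'.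
pose v := rho *: r; pose v' := rho' *: r'.
have v0 : v != 0 by rewrite scaler_eq0 negb_or gt_eqF.
have v0' : v' != 0 by rewrite scaler_eq0 negb_or gt_eqF.
have vker : (v <= kermx B^T)%MS.
  apply/sub_kermxP/rowP => i; rewrite mulmx_tr_row mxE sigmaZl.
  by have [_ ->] := BM i; rewrite mulr0.
have vker' : (v' <= kermx B^T)%MS.
  apply/sub_kermxP/rowP => i; rewrite mulmx_tr_row mxE.
  have [hM hr] := BM i; have [hD hx1] := hM.
  have [_] : facet D y' (row i B).
    by apply: hyy => //; split=> //; rewrite yE sigmaDl sigmaZl hr mulr0 addr0.
  rewrite yE' sigmaDl hx1 -/v'; lra.
have rk : (\rank (kermx B^T) <= 1)%N.
  by rewrite mxrank_ker mxrank_tr (eqP Bf) subSnn.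
have kv : (kermx B^T <= v)%MS.
  have := mxrank_leqif_sup vker; rewrite rank_rV v0 => -[le e].
  by rewrite -e eqn_leq le rk.
have /sub_rVP [c vc] := submx_trans vker' kv.
have [d [hd vd]] : exists d, facet D x d /\ sigma v d != 0.
  apply: contrapT => h; have /eqP := v0; apply; apply: (spans_ortho sx) => d hd.
  by apply: contrapT => /eqP hn; apply: h; exists d.
have vd0 : 0 < sigma v d.
  by rewrite lt_neqAle eq_sym vd sigmaZl mulr_ge0 ?(ltW rho0) ?rM.
have c0 : 0 < c.
  rewrite lt_neqAle; apply/andP; split.
    by apply: contra_neq v0' => c0; rewrite vc -c0 scale0r.
  rewrite -(pmulr_lge0 _ vd0) -sigmaZl -vc sigmaZl mulr_ge0 ?(ltW rho0') //.
  exact: rM'.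
have [c1|c1|c1] := ltrgtP c 1.
- have : v = 0.
    by apply: (@no_perfect_between x _ c); rewrite -?yE ?c0 // -vc -yE'.
  by move/eqP; rewrite (negbTE v0).
- have vv : v = c^-1 *: v' by rewrite vc scalerA mulVf ?scale1r // gt_eqF.
  have : v' = 0.
    apply: (@no_perfect_between x _ c^-1); rewrite -?yE' -?vv -?yE //.
    by rewrite invr_gt0 c0 invf_lt1.
  by move/eqP; rewrite (negbTE v0').
- by rewrite yE yE' -/v -/v' vc c1 scale1r.
Qed.

Lemma finite_adjacent x : P x -> finite_set (adjacent x).
Proof.
move=> Px; have /finite_seqP [s sE] := finite_facet T_unit T_A Px.1.1.
pose f y : {ffun 'I_(size s) ->
  bool} := [ffun i => `[< facet D y (nth 0 s (val i)) >]].
have [F [Ff FP hF]] := @finite_representatives _ _ (adjacent x) f finite_finset.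
apply: sub_finite_set Ff => y hy; have [z zF zy] := hF y hy.
suff <- : z = y by [].
have hz : adjacent x z by apply: FP.
apply: (adjacent_inj Px hz hy) => d hd hdz.
have ds : d \in s by move: hd; rewrite sE.
have hi : (index d s < size s)%N by rewrite index_mem.
have := congr1 (fun u : {ffun _ -> bool} => u (Ordinal hi)) zy.
by rewrite !ffunE /= nth_index // => e; apply/asboolP; rewrite -e;
  apply/asboolP.
Qed.

Lemma light_lor_le (c c' : vec) : quad H c <= 0 -> quad H c' <= 0 ->
  `|sigma (c *m H) c'| <= 2 * (`|c 0 0| * `|c' 0 0|).
Proof.
rewrite !quadHE => q q'; rewrite lorE.
have le (w : vec) : - w 0 0 ^+ 2 + spdot w w <= 0 -> spdot w w <= `|w 0 0| ^+ 2.
  by rewrite real_normK ?num_real //; lra.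
have := spdot_le (normr_ge0 _) (normr_ge0 _) (le _ q) (le _ q').
by have := ler_normD (- (c 0 0 * c' 0 0)) (spdot c c'); rewrite normrN normrM;
  lra.
Qed.

(** In the frame of [x] vectors of its facet have height [s^-1], and [s ^+ 2 >=
    C^-1]. *)
Lemma gram_bound : exists K : R, forall x d d', feasible V1 D x ->
  facet D x d -> facet D x d' -> `|sigma (d *m invmx AR) d'| <= K.
Proof.
have [C C0 hC] := short_lattice_point T_unit T_A.
exists (2 * C) => x d d' fx [hd d1] [hd' d1'].
have [T' [s [s0 s2 Tu' TA xT]]] := coneV1_frame T_unit fx.1;
  rewrite T_A in s2 TA.
have [sx qc] := frame_coords d Tu' TA xT;
  have [sx' qc'] := frame_coords d' Tu' TA xT.
have Cs : 1 <= C * s ^+ 2 by rewrite s2; apply: (feasible_quad hC fx).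
rewrite -TA invmx_frame // !mulmxA sigma_mulmx trmxK.
apply: le_trans (light_lor_le _ _) _.
- by rewrite -qc; apply: (D_qI T_unit T_A).
- by rewrite -qc'; apply: (D_qI T_unit T_A).
have t0 : (d *m invmx T'^T) 0 0 = s^-1.
  by apply: (mulfI (lt0r_neq0 s0)); rewrite -sx d1 divff // gt_eqF.
have t0' : (d' *m invmx T'^T) 0 0 = s^-1.
  by apply: (mulfI (lt0r_neq0 s0)); rewrite -sx' d1' divff // gt_eqF.
rewrite t0 t0' gtr0_norm ?invr_gt0 // -invfM -expr2 ler_pM2l //.
by rewrite -[leLHS]mul1r ler_pdivrMr // exprn_gt0.
Qed.

(** The products bounded in [gram_bound] become integers when multiplied by
    [\det A], which replaces the inverse of [A] by [\adj A]. *)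
Lemma perfect_integral_basis : exists K : nat, forall x, P x ->
  exists B : 'M[int]_n.+1, [/\ \det B != 0, x *m (int_mx R B)^T = const_mx 1
    & forall i j, (absz ((B *m \adj A *m B^T) i j)%R <= K)%N].
Proof.
have [K0 hK] := gram_bound.
pose K := Num.bound (`|\det AR| * `|K0|); exists K => x Px.
have [fx sx] := (perfect_pointsP _ _ _).1 Px.
have [B0 BM Bu] := spans_basis sx.
have hz i : exists z : 'rV[int]_n.+1, row i B0 = int_mx R z.
  by have [[]] := BM i.
pose B : 'M[int]_n.+1 := \matrix_i projT1 (cid (hz i)).
have BE : int_mx R B = B0.
  by apply/row_matrixP => i; rewrite /int_mx -map_row rowK;
    case: cid => z /= ->.
exists B; split.
- apply: contraTneq Bu => e; rewrite -BE unitmxE /int_mx det_map_mx e.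
  by rewrite unitfE eqxx.
- by apply/rowP => i; rewrite BE mulmx_tr_row mxE; case: (BM i).
move=> i j; rewrite -(ler_nat R) natr_absz intr_norm.
have -> : ((B *m \adj A *m B^T) i j)%:~R
    = \det AR * sigma (row i B0 *m invmx AR) (row j B0).
  have -> : ((B *m \adj A *m B^T) i j)%:~R = (B0 *m \adj AR *m B0^T) i j.
    have -> : \adj AR = int_mx R (\adj A) by rewrite /int_mx map_mx_adj.
    by rewrite -BE -int_mxT -!int_mxM [RHS]mxE.
  have -> : \adj AR = \det AR *: invmx AR.
    rewrite /invmx (intA_unit T_unit T_A) scalerA divff ?scale1r //.
    by rewrite -unitfE -unitmxE (intA_unit T_unit T_A).
  rewrite -scalemxAr -scalemxAl mxE; congr (_ * _).
  by rewrite -mulmx_tr_row -row_mul -row_mul [RHS]mxE.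
rewrite normrM; apply: le_trans (ltW (archi_boundP _));
  last by rewrite mulr_ge0.
rewrite ler_wpM2l //.
by apply: le_trans (hK x _ _ fx (BM i) (BM j)) (ler_norm _).
Qed.

(** The invariant of [x] is the Gram matrix of a chosen basis together with the
    residues of the basis modulo the determinant of this matrix. *)
Lemma finite_perfect_classes : exists F : set vec, [/\ finite_set F, F `<=` P &
  forall x, P x -> exists2 y, F y & exists2 g, Omega g & act y g = x].
Proof.
have [K hK] := perfect_integral_basis.
pose good x (B : 'M[int]_n.+1) := P x ->
  [/\ \det B != 0, x *m (int_mx R B)^T = const_mx 1
    & forall i j, (absz ((B *m \adj A *m B^T) i j)%R <= K)%N].
have [b hb] : {b : vec -> 'M[int]_n.+1 & forall x, good x (b x)}.
  apply: choice => x; have [Px|nPx] := pselect (P x); last by exists 0.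
  by have [B hB] := hK x Px; exists B.
pose gram x := b x *m \adj A *m (b x)^T.
pose f x := (gram x,
  \matrix_(i, j) modz (b x i j) (\det (gram x)) : 'M[int]_n.+1).
have A0 := detA_neq0 T_unit T_A.
have adj0 : \det (\adj A) != 0.
  have := congr1 determinant (mul_adj_mx A); rewrite det_mulmx det_scalar => e.
  apply: contraTneq (expf_neq0 n.+1 A0) => e0.
  by rewrite -e e0 mul0r eqxx.
have gram0 x : P x -> \det (gram x) != 0.
  by move=> /hb [b0 _ _]; rewrite !det_mulmx det_tr !mulf_neq0.
have fin : finite_set (f @` P).
  pose X := [set G : 'M[int]_n.+1 | forall i j, (absz (G i j) <= K)%N].
  pose Y (G : 'M[int]_n.+1) :=
    [set M : 'M[int]_n.+1 | forall i j, (absz (M i j) <= absz (\det G))%N].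
  apply: (@sub_finite_set _ _ (X `*`` Y)); last first.
    by apply: finite_setXR => [|G _]; exact: finite_int_mx.
  move=> _ [x Px <-]; have [_ _ hx] := hb x Px; split=> //= i j.
  rewrite mxE -lez_nat gez0_abs ?modz_ge0 ?gram0 //.
  by rewrite ltW // ltz_mod ?gram0.
have [F [Ff FP hF]] := finite_representatives fin.
exists F; split=> // x Px; have [y Fy yx] := hF x Px; exists y => //.
have Py := FP y Fy; have [bx0 x1 _] := hb x Px; have [by0 y1 _] := hb y Py.
have [g gu [bg gS]] : exists2 g, g \in unitmx &
    b y = b x *m g /\ g *m \adj A *m g^T = \adj A.
  have e1 : gram y = gram x by case: yx.
  apply: congruent_bases => // [|i j]; first exact: gram0.
  have /matrixP/(_ i j) : (f y).2 = (f x).2 by rewrite yx.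
  by rewrite !mxE e1 => e; rewrite -/(gram x) e.
have yg : act y g^T = x.
  have Bu : (int_mx R (b x))^T \in unitmx.
    rewrite unitmx_tr unitmxE /int_mx det_map_mx unitfE intr_eq0 //.
  rewrite -[RHS](mulmxK Bu) x1 -y1 bg int_mxM trmx_mul mulmxA mulmxK //.
  by rewrite /act int_mxT.
exists g^T => //; apply: (@reduced_autP _ y); last 2 first.
- exact: Py.1.1.
- by rewrite yg; exact: Px.1.1.
split; first by rewrite unitmx_tr.
rewrite trmxK; apply: (mulmx_int_inj adj0).
have gT0 : \det g != 0.
  by move: gu; rewrite unitmxE; apply: contraTneq => ->; rewrite unitr0.
apply: (mulmx_int_inj gT0).
rewrite mul_adj_mx; have <- : g *m \adj A *m g^T *m (A *m g)
    = g *m (\adj A *m (g^T *m A *m g)).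
  by rewrite !mulmxA.
by rewrite gS mulmxA mul_adj_mx scalar_mxC.
Qed.
End Finiteness.
(** * The Voronoi procedure *)

Lemma xget_default (U : choiceType) (x y : U) (E : set U) :
  (exists z, E z) -> xget x E = xget y E.
Proof.
move=> [z Ez]; rewrite /xget; case: pselect => // nE.
by case: nE; exists z; apply/asboolP.
Qed.

Lemma count_lt (U : eqType) (a b : pred U) (s : seq U) u :
  subpred a b -> u \in s -> b u -> ~~ a u -> (count a s < count b s)%N.
Proof.
move=> ab; elim: s => //= w s IH; rewrite inE => /orP[/eqP <- bu au|us bu au].
  by rewrite bu (negbTE au) add0n add1n ltnS sub_count.
by rewrite -addnS leq_add ?IH //; case: (boolP (a w)) => // /ab ->.
Qed.

Section Procedure.
Variables (R : realType) (n : nat).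
Local Notation vec := 'rV[R]_n.+1.
Variables (V1 D : set vec) (Omega : set 'M[int]_n.+1).
Implicit Types (x y : vec) (L : set vec) (S : set 'M[int]_n.+1).
Local Notation P := (perfect_points V1 D).
Local Notation step := (step V1 D Omega).
Local Notation terminates := (terminates V1 D Omega).

Hypothesis Omega_group : is_subgroup Omega.
Hypothesis perfect_exists : exists x, P x.
Hypothesis neighbours_finite : forall x, P x -> finite_set (neighbours V1 D x).

Definition equivalent x y := exists2 g, Omega g & act x g = y.

Lemma equivalent_sym x y : equivalent x y -> equivalent y x.
Proof.
case: Omega_group => uG _ _ vG [g gO <-]; exists (invmx g); first exact: vG.
by rewrite actK //; apply: uG.
Qed.

Lemma equivalent_trans y x z : equivalent x y -> equivalent y z ->
  equivalent x z.
Proof.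
case: Omega_group => _ _ mG _ [g gO <-] [h hO <-]; exists (g *m h);
  first exact: mG.
by rewrite actM.
Qed.

(** The choice operator depends only on the set to choose from, so it picks the
    same representative for all elements of an orbit. *)
Lemma transversal_exists G (Y : set vec) : is_subgroup G ->
  exists Y', transversal_of G Y Y'.
Proof.
move=> gG; have [_ oG mG vG] := gG.
pose rep y := xget y [set z | Y z /\ orbit_of G y z].
have repP y : Y y -> Y (rep y) /\ orbit_of G y (rep y).
  move=> Yy; apply: (@xgetPex _ y [set z | Y z /\ orbit_of G y z]).
  by exists y; split=> //; exists 1%:M; rewrite ?act1.
have orbE y z : orbit_of G y z -> orbit_of G z = orbit_of G y.
  by move=> [g Gg <-]; apply: orbit_act.
have repE y z : Y y -> orbit_of G y z -> Y z -> rep z = rep y.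
  move=> Yy yz Yz; rewrite /rep (orbE _ _ yz); set E := [set _ | _].
  apply: xget_default; exists y; split=> //.
  by exists 1%:M; rewrite ?act1.
exists (rep @` Y); split=> [_ [y Yy <-]|y Yy]; first by case: (repP y Yy).
exists (rep y); split; first by split; [exists y|case: (repP y Yy)].
move=> _ [[z Yz <-] yz]; apply: esym; apply: repE => //.
have [_ zz] := repP z Yz; rewrite -(orbE _ _ yz) (orbE _ _ zz).
by exists 1%:M; rewrite ?act1.
Qed.

(** The invariant of the procedure; that the elements of [L2] are pairwise
    inequivalent follows from the way [L2] grows, and the measure [untreated]
    records it. *)
Definition independent L1 L2 :=
  [/\ L1 `<=` P, (forall a b, L1 a -> L2 b -> ~ equivalent a b)
    & forall a a', L1 a -> L1 a' -> equivalent a a' -> a = a'].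

Lemma step5_inv x todo L1 L2 S c : step (Step5 x todo L1 L2 S) c ->
  [\/ exists y, [/\ todo y, ~ (exists z g,
          [/\ (L1 `|` L2) z, Omega g & act y g = z]) &
            c = Step5 x (todo `\ y) (L1 `|` [set y]) L2 S],
      exists y S', todo y /\ c = Step5 x (todo `\ y) L1 L2 S'
    | todo = set0 /\ c = Step6 x L1 L2 S].
Proof.
move=> st; inversion st; subst.
- by constructor 1; exists y.
- by constructor 2; exists y, (S `|` [set g]).
- by constructor 2; exists y, S.
- by constructor 3.
Qed.

Lemma step4_inv x L1 L2 S c : step (Step4 x L1 L2 S) c ->
  exists R', transversal_of (stab Omega x) (neighbours V1 D x) R' /\
    c = Step5 x R' L1 L2 S.
Proof. by move=> st; inversion st; subst; exists R'. Qed.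

(** Whether or not its class is new, each treated element leaves [todo]. *)
Lemma terminates_step5 x L2 : (forall L1 S, independent L1 L2 -> L1 x ->
    terminates (Step6 x L1 L2 S)) ->
  forall (t : seq vec) todo L1 S, todo `<=` P -> todo `<=` [set` t] ->
  independent L1 L2 -> L1 x -> terminates (Step5 x todo L1 L2 S).
Proof.
move=> h6 t; have [m] := ubnP (size t); elim: m t => // m IH t tm.
move=> todo L1 S tP tt ind L1x; apply: terminates_step.
  have [->|] := eqVneq todo set0; first by eexists; apply: step_loop_end.
  move=> /set0P [y ty].
  have [[z [z12 [g gO yz]]]|no] := pselect (exists z, (L1 `|` L2) z /\ equivalent y z).
    have [z1|z1] := pselect (L1 z); first by eexists; apply: step_old_L1 yz.
    by case: z12 => // z2; eexists; apply: step_old_L2 z1 gO yz.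
  eexists; apply: (step_new _ _ _ _ ty) => -[z [g [z12 gO yz]]].
  by apply: no; exists z; split=> //; exists g.
have small y : todo y -> (size [seq z <- t | z != y] < m)%N.
  move=> /tt /= yt; apply: leq_trans (_ : size t <= m)%N; last by rewrite -ltnS.
  rewrite size_filter -(count_predC (fun z => z != y)).
  rewrite -[X in (X < _)%N]addn0 ltn_add2l.
  by rewrite -has_count; apply/hasP; exists y => //=; rewrite negbK.
have sub y : todo `\ y `<=` [set` [seq z <- t | z != y]].
  by move=> z [/tt /= zt /eqP zy]; rewrite mem_filter zy.
have subP y : todo `\ y `<=` P by move=> z [/tP].
move=> c' /step5_inv [[y [ty no ->]]|[y [S' [ty ->]]]|[_ ->]]; last exact: h6.
  apply: IH (small _ ty) _ _ _ (subP _) (sub _) _ _; last by left.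
  case: ind => LP L12 L11.
  have new z : (L1 `|` L2) z -> ~ equivalent y z.
    by move=> z12 [g gO yz]; apply: no; exists z, g.
  split=> [z [/LP //|->]|a b [a1|->] b2|a a' [a1|->] [a1'|->]] //.
  - exact: tP.
  - exact: L12.
  - by apply: new; right.
  - exact: L11.
  - by move=> /equivalent_sym e; case: (new a _ e); left.
  - by move=> e; case: (new a' _ e); left.
exact: IH (small _ ty) _ _ _ (subP _) (sub _) _ _.
Qed.

Variable F : seq vec.
Hypothesis F_classes : forall x, P x -> exists2 y, y \in F & equivalent y x.

Definition untreated L2 :=
  count (fun y => ~~ `[< exists2 z, L2 z & equivalent y z >]) F.

(** One passage through the loop moves [x] to [L2]; by independence the class
    of [x] was not met by [L2] before, so [untreated] drops. *)
Lemma terminates_step2 L1 L2 S : independent L1 L2 ->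
  terminates (Step2 L1 L2 S).
Proof.
have [m] := ubnP (untreated L2); elim: m L1 L2 S => // m IH L1 L2 S Lm ind.
apply: terminates_step.
  have [->|] := eqVneq L1 set0; first by eexists; apply: step_return.
  by move=> /set0P [x L1x]; eexists; apply: step_choose L1x.
move=> c' st; inversion st; subst; first exact: terminates_return.
have Px : P x by case: ind => LP _ _; apply: LP.
have gx := stab_subgroup x Omega_group.
apply: terminates_step.
  by eexists; apply: (@step_stabilizer _ _ _ _ _ _ _ _ _ (stab Omega x));
    apply: smallest_id.
move=> {st} c' st; inversion st; subst; apply: terminates_step.
  have [Y' hY] := transversal_exists (neighbours V1 D x) gx.
  by eexists; apply: step_neighbours hY.
move=> {st} _ /step4_inv [Y' [[Y'Y _] ->]].
have /finite_seqP [t tE] := neighbours_finite Px.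
apply: (@terminates_step5 x L2 _ t) => //; last 2 first.
- by move=> y /Y'Y [r [rho []]].
- by rewrite -tE.
move=> L1' S' [LP L12 L11] L1x'; apply: terminates_step.
  by eexists; apply: step_done.
move=> c' st; inversion st; subst; apply: IH; last first.
  split=> [a [/LP //]|a b [a1 ax] [b2|->]|a a' [a1 _] [a1' _]].
  - exact: L12.
  - by move=> e; apply: ax; apply: L11.
  - exact: L11.
have [y yF yx] := F_classes Px.
have sub : subpred (fun y => ~~ `[< exists2 z, (L2 `|` [set x]) z &
  equivalent y z >])
    (fun y => ~~ `[< exists2 z, L2 z & equivalent y z >]).
  by move=> w; apply: contraNN => /asboolP [z z2 wz]; apply/asboolP;
    exists z => //; left.
rewrite -ltnS; apply: leq_trans Lm; rewrite ltnS.
apply: (count_lt sub yF).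
  by apply/asboolP => -[z z2 yz]; apply: (L12 x z) => //;
    apply: equivalent_trans yz; apply: equivalent_sym.
by rewrite negbK; apply/asboolP; exists x => //; right.
Qed.

Lemma voronoi_terminates : voronoi_procedure_terminates V1 D Omega.
Proof.
apply: terminates_step.
  by have [x Px] := perfect_exists; eexists; apply: step_start Px.
move=> c' st; inversion st; subst; apply: terminates_step2.
by split=> [y -> //|a b _ //|a a' -> ->].
Qed.
End Procedure.
(** * The theorem *)

Section Quotient.
Variables (R : realType) (n : nat).
Local Notation vec := 'rV[R]_n.+1.
Variables (A : 'M[int]_n.+1) (T : 'M[R]_n.+1).
Hypothesis T_unit : T \in unitmx.
Hypothesis T_A : T *m Hmx R n *m T^T = int_mx R A.
Local Notation V1 := (coneV1 T).
Local Notation D := (lattice_points (coneV2 T)).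
Local Notation Omega := (reduced_aut A V1).

Lemma quotient_finite : quotient_graph_finite V1 D Omega.
Proof.
have gO := Omega_subgroup T_unit T_A.
have [F [Ff FP hF]] := finite_perfect_classes T_unit T_A.
split.
  apply: (@sub_finite_set _ _ ((fun x => orbit_of Omega x) @` F)).
    move=> _ [x Px <-]; have [y Fy [g gg yx]] := hF x Px; exists y => //.
    by rewrite -yx orbit_act.
  exact: finite_image.
pose E := \bigcup_(x in F) [set [set x; y] | y in adjacent V1 D x].
pose orb (e : set vec) := [set [set act x g | x in e] | g in Omega].
apply: (@sub_finite_set _ _ (orb @` E)); last first.
  apply/finite_image/bigcup_finite => // x Fx; apply: finite_image.
  exact: (finite_adjacent T_unit T_A (FP x Fx)).
move=> _ [_ [x [y [Px xy ->]] <-]].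
have [x0 Fx0 [g gg x0x]] := hF x Px.
have gu := Omega_unit gg.
have gV := Omega_inv T_unit T_A gg.
exists [set x0; act y (invmx g)].
  exists x0 => //; exists (act y (invmx g)) => //.
  have := adjacent_act T_unit T_A gV Px (neighbours_adjacent xy).
  by rewrite -x0x actK.
rewrite /orb -(set_orbit_act _ gO gg); congr image; apply/funext => h;
  congr image.
apply/seteqP; split=> [_ [z [->|->] <-]|z [->|->]].
- by left.
- by right; rewrite actVK.
- by exists x0 => //; left.
- by exists (act y (invmx g)); [right|rewrite actVK].
Qed.
End Quotient.

Theorem theorem3p15 (R : realType) (n : nat) (A : 'M[int]_n.+1)
    (A_sym : A^T = A) (A_sig : lorentzian (int_mx R A))
    (T : 'M[R]_n.+1) (T_unit : T \in unitmx)
    (T_A : T *m Hmx R n *m T^T = int_mx R A) :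
  let V1 := coneV1 T in
  let V2 := coneV2 T in
  let Omega := reduced_aut A V1 in
  let D := lattice_points V2 in
  quotient_graph_finite V1 D Omega /\ voronoi_procedure_terminates V1 D Omega.
Proof.
move=> V1 V2 Omega D; split; first exact: quotient_finite.
have [F [/finite_seqP [s Fs] _ hF]] := finite_perfect_classes T_unit T_A.
apply: (@voronoi_terminates _ _ _ _ _ _ _ _ s).
- exact: Omega_subgroup.
- exact: exists_perfect T_unit T_A.
- move=> x Px; apply: sub_finite_set (finite_adjacent T_unit T_A Px).
  exact: neighbours_adjacent.
- by move=> x Px; have [y Fy yx] := hF x Px; exists y => //; move: Fy;
  rewrite Fs.
Qed.
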